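(* For all real $x\ge 1$, \[ \sum_{n\le x}\Delta(n)\ll x\,(\operatorname{Log}_2 x)^{11/4}, \] where the implied constant is absolute.
   Context: For a natural number $n$ and real $u$, let $\Delta(n;u)=\#\{d\mid n:\ e^u<d\le e^{u+1}\}$, and let $\Delta(n)=\sup_{u\in\mathbb{R}}\Delta(n;u)$ (the Erdős–Hooley Delta function). For $x>0$, $\operatorname{Log} x=\max\{1,\log x\}$ and $\operatorname{Log}_2 x=\operatorname{Log}(\operatorname{Log} x)$. The notation $X\ll Y$ means $|X|\le CY$ for some constant $C$. *)

(* Defs.v *)
From Stdlib Require Import Reals Lra Lia List Arith.
From Coquelicot Require Import Coquelicot.
Open Scope R_scope.

Definition Delta_u (n : nat) (u : R) : nat :=
  length (filter (fun d => (Nat.eqb (n mod d) 0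
                            && (if Rlt_dec (exp u) (INR d) then true else false)
                            && (if Rle_dec (INR d) (exp (u + 1)) then true else false))%bool)
                 (seq 1 n)).

(* DeltaEH n = Delta(n) = sup_u Delta(n;u), as a real (Lub_Rbar is finite here since Delta(n;u) <= n) *)
Definition DeltaEH (n : nat) : R :=
  real (Lub_Rbar (fun y => exists u : R, y = INR (Delta_u n u))).

Definition Log (x : R) : R := Rmax 1 (ln x).
Definition Log2 (x : R) : R := Log (Log x).

Definition sum_le (x : R) (f : nat -> R) : R :=
  fold_right Rplus 0 (map f (seq 1 (Z.to_nat (Int_part x)))).

(* Main.v *)
From Stdlib Require Import ZArith Reals Lra.
From Coquelicot Require Import Coquelicot.
From HB Require Import structures.
From mathcomp Require Import all_boot zify.
Require Import Defs.

Set Implicit Arguments.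
Unset Strict Implicit.
Unset Printing Implicit Defensive.
Delimit Scope R_scope with R.
Open Scope R_scope.

(** Replace an integer by the random decreasing list of its primes, where [p] is present
    with probability [1 / (p + 1)], independently. Let [M_j] be the [j]-th moment of the
    number of divisors in a window of logarithmic length 1, [tau = M_1] the number of
    divisors, and [lam] the mean of [tau]. Inserting a prime [p] doubles [M_j] and adds
    correlations of the window count with its translate by [ln p]; by Chebyshev and
    Mertens, their sum over [p] is [O(2 ^ min(i, k) M_i M_k / lam)].

    Fix [A >= 1] and stop as soon as [M_j > A ^ j c_j (6 / 5) ^ (j - 1) lam] for some
    [j <= Q], where [c_j = D ^ (j - 1) (j!) ^ (7 / 4)]. Before stopping [tau <= A lam], so
    the weight [1 / lam] may be replaced by the larger [sqrt (A / (tau lam))], under which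
    the mean of [tau] decays like a power of [lam]. Hence the sources of [M_j / lam]
    total at most [A ^ (j - 1) c_j], by induction on [j], and the maximal inequality
    bounds the probability of stopping by [12 / A]. If there is no stop and
    [lam <= 3 ^ Q], then [M_Q] bounds every window count by [O(A Q ^ (7 / 4))]. Summing
    over the dyadic [A <= 2 ^ (5 Q)] gives the mean [O(Q ^ (11 / 4))], with [Q] of the
    order of [Log_2 x].

    Finally [n = k ^ 2 m] with [m] squarefree gives [Delta(n) <= tau(k) ^ 2 Delta(m)], and
    writing [ln n] as a sum over primes turns the mean over [n <= x] into the mean of the
    model. *)

(** Without stopping, [tau / lam] is a martingale: under the weight [1 / lam] nothing decays, and
    sources would pile up over all scales of [p]. Under [sqrt (A / (tau lam))] an insertion
    multiplies the weighted [tau] by [sqrt 2] instead of 2, and [1 - q + sqrt 2 * q] lies below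
    [sqrt (1 + q)]; the price is the value [sqrt A] at the empty list.

    The factor [1 / lam] in the sum over primes closes the induction. A source of order [j] is
    controlled by [M_i M_k / lam] with [i + k = j]; as long as there is no stop, the moment of
    smaller order is at most a constant times [lam], which cancels, and only the total of the other
    moment remains. The powers of [A] match too, since [A ^ i A ^ (k - 1) = A ^ (j - 1)]. The case
    [i = k = 1] does not fit, because the total of order 1 is at least [sqrt A].

    The exponent [11 / 4] is [7 / 4 + 1]. At order [Q], the [Q]-th roots of [lam] and of [c_Q] are
    [O(1)] and [O(Q ^ (7 / 4))]. The tail [12 / A] then makes every dyadic [A] contribute equally to
    the mean, and there are [O(Q)] of them. *)

Lemma RplusA : associative Rplus. Proof. by move=> x y z; lra. Qed.
Lemma RplusC : commutative Rplus. Proof. by move=> x y; lra. Qed.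
Lemma Rplus0 : left_id 0 Rplus. Proof. by move=> x; lra. Qed.
Lemma Rmult0l : left_zero 0 Rmult. Proof. by move=> x; lra. Qed.
Lemma Rmult0r : right_zero 0 Rmult. Proof. by move=> x; lra. Qed.
Lemma RmultDl : left_distributive Rmult Rplus. Proof. by move=> x y z; lra. Qed.
Lemma RmultDr : right_distributive Rmult Rplus. Proof. by move=> x y z; lra. Qed.

HB.instance Definition _ := Monoid.isComLaw.Build R 0 Rplus RplusA RplusC Rplus0.
HB.instance Definition _ := Monoid.isMulLaw.Build R 0 Rmult Rmult0l Rmult0r.
HB.instance Definition _ := Monoid.isAddLaw.Build R Rmult Rplus RmultDl RmultDr.

Notation "\sum_ ( i <- r | P ) F" := (\big[Rplus/0%R]_(i <- r | P%B) F%R) : R_scope.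
Notation "\sum_ ( i <- r ) F" := (\big[Rplus/0%R]_(i <- r) F%R) : R_scope.
Notation "\sum_ ( m <= i < n | P ) F" := (\big[Rplus/0%R]_(m <= i < n | P%B) F%R) : R_scope.
Notation "\sum_ ( m <= i < n ) F" := (\big[Rplus/0%R]_(m <= i < n) F%R) : R_scope.

Section RealSums.
Variables (I : eqType).
Implicit Types (r : seq I) (P : pred I) (F : I -> R).

Lemma sumR_ge0 r P F :
  (forall i, i \in r -> P i -> 0 <= F i) -> 0 <= \sum_(i <- r | P i) F i.
Proof.
move=> H; rewrite big_seq_cond; apply: (big_ind (fun x => 0 <= x)) => [|x y *|i /andP[]]; [lra|lra|exact: H].
Qed.

Lemma leR_sum r P F F' :
  (forall i, i \in r -> P i -> F i <= F' i) ->
  \sum_(i <- r | P i) F i <= \sum_(i <- r | P i) F' i.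
Proof.
move=> H; rewrite big_seq_cond [X in _ <= X]big_seq_cond.
by apply: (big_ind2 Rle) => [|x y x' y' *|i /andP[]]; [lra|lra|exact: H].
Qed.

Lemma sumR_mulr r P F c :
  \sum_(i <- r | P i) (c * F i) = c * \sum_(i <- r | P i) F i.
Proof. by rewrite big_distrr. Qed.

Lemma sumR_mull r P F c :
  \sum_(i <- r | P i) (F i * c) = (\sum_(i <- r | P i) F i) * c.
Proof. by rewrite big_distrl. Qed.

Lemma sumR_cond r P F :
  \sum_(i <- r | P i) F i = \sum_(i <- r) ((if P i then 1 else 0) * F i).
Proof. by rewrite big_mkcond; apply: eq_bigr => i _; case: (P i); lra. Qed.

Lemma sumR_subset r P P' F :
  (forall i, i \in r -> P' i -> 0 <= F i) -> (forall i, i \in r -> P i -> P' i) ->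
  \sum_(i <- r | P i) F i <= \sum_(i <- r | P' i) F i.
Proof.
move=> H0 HP; rewrite sumR_cond [X in _ <= X]sumR_cond; apply: leR_sum => i ir _.
by case: (boolP (P i)) => [/(HP _ ir) ->|_]; [lra|case: (boolP (P' i)) => [/(H0 _ ir)|_]; lra].
Qed.

Lemma sumR_const r c : \sum_(i <- r) c = INR (size r) * c.
Proof.
by elim: r => [|i r IH]; rewrite ?big_nil ?big_cons /= -?/(INR _.+1) ?S_INR ?IH; lra.
Qed.

Lemma leR_sum_term r F i :
  i \in r -> (forall j, j \in r -> 0 <= F j) -> F i <= \sum_(j <- r) F j.
Proof.
move=> ir H; rewrite (big_rem i ir) /=.
suff: 0 <= \sum_(j <- rem i r) F j by lra.
by apply: sumR_ge0 => j /mem_rem jr _; apply: H.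
Qed.

End RealSums.

Lemma INR_addn a b : INR (a + b)%N = INR a + INR b.
Proof. exact: plus_INR. Qed.

Lemma INR_muln a b : INR (a * b)%N = INR a * INR b.
Proof. exact: mult_INR. Qed.

Lemma INR_expn a k : INR (a ^ k)%N = INR a ^ k.
Proof. by elim: k => [|k IH] //; rewrite expnS INR_muln IH. Qed.

Lemma INR_leq a b : (a <= b)%N -> INR a <= INR b.
Proof. by move=> ab; apply: le_INR; apply/leP. Qed.

Lemma leq_INR a b : INR a <= INR b -> (a <= b)%N.
Proof. by move=> ab; apply/leP; apply: INR_le. Qed.

Lemma INR_sum (I : Type) (r : seq I) (P : pred I) (F : I -> nat) :
  INR (\sum_(i <- r | P i) F i)%N = \sum_(i <- r | P i) INR (F i).
Proof. exact: (big_morph INR INR_addn). Qed.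

(** * The random list *)

(* The law of a random decreasing list of integers at most [m], in which [p]
   occurs with probability [q p], independently. *)
Section Model.
Variable q : nat -> R.
Hypothesis q_ge0 : forall p, 0 <= q p.
Hypothesis q_le : forall p, q p <= 1 / 3.

Fixpoint Ex (m : nat) (f : seq nat -> R) : R :=
  if m is m'.+1 then (1 - q m) * Ex m' f + q m * Ex m' (fun n => f (m :: n))
  else f [::].

Fixpoint lam (m : nat) : R := if m is m'.+1 then lam m' * (1 + q m) else 1.

(* [births N f] sums [f] over the lists seen just after each insertion, the gaps
   between insertions being unweighted. *)
Fixpoint births (N : nat) (f : seq nat -> R) : R :=
  if N is N'.+1 then births N' f + q N * Ex N' (fun n => f (N :: n)) else f [::].

Definition total (N : nat) (F : nat -> seq nat -> R) : R :=
  \sum_(0 <= p < N) (q p.+1 * Ex p (F p.+1)).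

Lemma Ex_le m f f' :
  (forall n, path gtn m.+1 n -> f n <= f' n) -> Ex m f <= Ex m f'.
Proof.
elim: m f f' => [|m IH] f f' H /=; first exact: H.
have h1 : Ex m f <= Ex m f'.
  apply: IH => n hn; apply: H.
  by case: n hn => //= p n /andP[h ->]; rewrite andbT; apply: leq_trans h _.
have h2 : Ex m (fun n => f (m.+1 :: n)) <= Ex m (fun n => f' (m.+1 :: n)).
  by apply: IH => n hn; apply: H => /=; rewrite ltnSn.
have := q_ge0 m.+1; have := q_le m.+1; nra.
Qed.

Lemma Ex_ext m f f' :
  (forall n, path gtn m.+1 n -> f n = f' n) -> Ex m f = Ex m f'.
Proof. by move=> H; apply: Rle_antisym; apply: Ex_le => n /H ->; lra. Qed.

Lemma Ex_const m c : Ex m (fun=> c) = c.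
Proof. by elim: m => [|m /= ->] //; lra. Qed.

Lemma ExD m f f' : Ex m (fun n => f n + f' n) = Ex m f + Ex m f'.
Proof. by elim: m f f' => [|m IH] f f' //=; rewrite !IH; lra. Qed.

Lemma ExZ m c f : Ex m (fun n => c * f n) = c * Ex m f.
Proof. by elim: m f => [|m IH] f //=; rewrite !IH; lra. Qed.

Lemma Ex_sum m (I : Type) (r : seq I) (F : I -> seq nat -> R) :
  Ex m (fun n => \sum_(i <- r) F i n) = \sum_(i <- r) Ex m (F i).
Proof.
elim: r => [|i r IH].
  by rewrite big_nil -[RHS](Ex_const m 0); apply: Ex_ext => n _; rewrite big_nil.
by rewrite big_cons -IH -ExD; apply: Ex_ext => n _; rewrite big_cons.
Qed.

Lemma Ex_ge0 m f : (forall n, path gtn m.+1 n -> 0 <= f n) -> 0 <= Ex m f.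
Proof. by move=> H; rewrite -(Ex_const m 0); apply: Ex_le. Qed.

Lemma lam_ge1 m : 1 <= lam m.
Proof. by elim: m => [|m IH] /=; [lra|have := q_ge0 m.+1; nra]. Qed.

Lemma lam_gt0 m : 0 < lam m.
Proof. by have := lam_ge1 m; lra. Qed.

Lemma lam_le m m' : (m <= m')%N -> lam m <= lam m'.
Proof.
move=> /subnKC <-; elim: (m' - m)%N => [|k IH]; first by rewrite addn0; lra.
by rewrite addnS /=; have := q_ge0 (m + k).+1; have := lam_gt0 (m + k); nra.
Qed.

Lemma births_le N f f' :
  (forall n, path gtn N.+1 n -> f n <= f' n) -> births N f <= births N f'.
Proof.
elim: N f f' => [|N IH] f f' H /=; first exact: H.
have h1 : births N f <= births N f'.
  apply: IH => n hn; apply: H.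
  by case: n hn => //= p n /andP[h ->]; rewrite andbT; apply: leq_trans h _.
have h2 : Ex N (fun n => f (N.+1 :: n)) <= Ex N (fun n => f' (N.+1 :: n)).
  by apply: Ex_le => n hn; apply: H => /=; rewrite ltnSn.
have := q_ge0 N.+1; nra.
Qed.

Lemma births_ext N f f' :
  (forall n, path gtn N.+1 n -> f n = f' n) -> births N f = births N f'.
Proof. by move=> H; apply: Rle_antisym; apply: births_le => n /H ->; lra. Qed.

Lemma birthsD N f f' : births N (fun n => f n + f' n) = births N f + births N f'.
Proof. by elim: N => [|N IH] //=; rewrite IH ExD; lra. Qed.

Lemma birthsZ N c f : births N (fun n => c * f n) = c * births N f.
Proof. by elim: N => [|N IH] //=; rewrite IH ExZ; lra. Qed.

Lemma births_sum N (I : Type) (r : seq I) (F : I -> seq nat -> R) :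
  births N (fun n => \sum_(i <- r) F i n) = \sum_(i <- r) births N (F i).
Proof.
elim: N => [|N IH] //=; rewrite IH Ex_sum big_split /=; congr (_ + _).
by rewrite big_distrr.
Qed.

Lemma birthsE N f :
  births N f = f [::] + total N (fun p n => f (p :: n)).
Proof.
rewrite /total; elim: N => [|N IH] /=; first by rewrite big_nil; lra.
by rewrite IH big_nat_recr //=; lra.
Qed.

(** The list at stage [m] arose at its last insertion, or is still empty; the probability that
    nothing was inserted since is at most 1. *)
Lemma Ex_births m f : (forall n, 0 <= f n) -> Ex m f <= births m f.
Proof.
elim: m f => [|m IH] f H /=; first lra.
have := IH _ H; have h : 0 <= Ex m f by apply: Ex_ge0.
have := q_ge0 m.+1; nra.
Qed.

(** Each stage [p] is charged to the last insertion before it, at [head 0 n]. The chance that the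
    list survives unchanged until [p] is replaced by 1, so that the weights [q p] attached to one
    list can be summed on their own. *)
Lemma total_births N F :
  (forall p n, 0 <= F p n) ->
  total N F <= births N (fun n => \sum_(head 0%N n <= p < N) (q p.+1 * F p.+1 n)).
Proof.
move=> F0; rewrite /total; elim: N => [|N IH] /=.
  by rewrite !big_nil; lra.
rewrite big_nat_recr //=.
set B := births N (fun n => \sum_(_ <= p < N.+1) _).
have -> : B = births N (fun n => \sum_(head 0%N n <= p < N) (q p.+1 * F p.+1 n))
              + q N.+1 * births N (F N.+1).
  rewrite -birthsZ -birthsD; apply: Rle_antisym; apply: births_le => n hn;
    rewrite big_nat_recr /=; try lra; case: n hn => //= p n /andP[]; lia.
have := Ex_births N (F0 N.+1).
have h : 0 <= Ex N (fun n => \sum_(head 0%N (N.+1 :: n) <= p < N.+1) (q p.+1 * F p.+1 (N.+1 :: n))).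
  apply: Ex_ge0 => n _; apply: sumR_ge0 => p _ _.
  by apply: Rmult_le_pos.
move: h => /=; have := q_ge0 N.+1; nra.
Qed.

Lemma total_le N F F' :
  (forall p n, (p < N)%N -> path gtn p.+1 n -> F p.+1 n <= F' p.+1 n) ->
  total N F <= total N F'.
Proof.
move=> H; apply: leR_sum => p; rewrite mem_index_iota => /andP[_ pN] _.
by apply: Rmult_le_compat_l => //; apply: Ex_le => n hn; apply: H.
Qed.

Lemma totalD N F F' : total N (fun p n => F p n + F' p n) = total N F + total N F'.
Proof. by rewrite /total -big_split; apply: eq_bigr => p _; rewrite ExD /=; lra. Qed.

Lemma totalZ N c F : total N (fun p n => c * F p n) = c * total N F.
Proof. by rewrite /total big_distrr; apply: eq_bigr => p _; rewrite ExZ /=; lra. Qed.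

Lemma total_sum N (I : Type) (r : seq I) (F : I -> nat -> seq nat -> R) :
  total N (fun p n => \sum_(i <- r) F i p n) = \sum_(i <- r) total N (F i).
Proof.
rewrite /total exchange_big; apply: eq_bigr => p _ /=.
by rewrite Ex_sum big_distrr.
Qed.

Lemma total_ge0 N F :
  (forall p n, (p < N)%N -> path gtn p.+1 n -> 0 <= F p.+1 n) -> 0 <= total N F.
Proof.
move=> H; apply: sumR_ge0 => p; rewrite mem_index_iota => /andP[_ pN] _.
by apply: Rmult_le_pos => //; apply: Ex_ge0 => n hn; apply: H.
Qed.

(* If [T] doubles at each insertion up to the source [S], then [T / lam] is a
   martingale up to [S]; [g] is a stopping indicator, [g n - g (p :: n)] its exits. *)
Lemma flux (g T : seq nat -> R) (S : nat -> seq nat -> R) N :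
  (forall n, 0 <= g n) -> (forall p n, T (p :: n) <= 2 * T n + S p n) ->
  total N (fun p n => (g n - g (p :: n)) * T (p :: n) / lam p)
    + Ex N (fun n => g n * T n) / lam N
  <= g [::] * T [::] + total N (fun p n => g n * S p n / lam p).
Proof.
move=> g0 TS; rewrite /total; elim: N => [|N IH] /=; first by rewrite !big_nil; lra.
rewrite !big_nat_recr //=.
set e := Ex N (fun n => (g n - _) * _ / _).
set s := Ex N (fun n => g n * S _ _ / _).
set u := Ex N (fun n => g n * T n) in IH *; set v := Ex N (fun n => g _ * T _).
have l0 := lam_gt0 N; have Q0 := q_ge0 N.+1; have Q1 := q_le N.+1.
set c := (1 + q N.+1).
(* The surviving part and the exits add up to [g n * T (N.+1 :: n)], to which the doubling
   hypothesis applies. *)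
have key : v / (lam N * c) + e <= 2 * u / (lam N * c) + s.
  have -> : 2 * u / (lam N * c) = Ex N (fun n => 2 / (lam N * c) * (g n * T n)).
    by rewrite ExZ /u; lra.
  have -> : v / (lam N * c) = Ex N (fun n => / (lam N * c) * (g (N.+1 :: n) * T (N.+1 :: n))).
    by rewrite ExZ /v; lra.
  rewrite -!ExD; apply: Ex_le => n _.
  have := g0 n; have := TS N.+1 n.
  have h : 0 < / (lam N * c) by apply: Rinv_0_lt_compat; rewrite /c; nra.
  rewrite /Rdiv /c in h *; move: (/ _) h => i h TS' gn.
  have : 0 <= (2 * T n + S N.+1 n - T (N.+1 :: n)) * g n * i.
    by apply: Rmult_le_pos; [apply: Rmult_le_pos|]; lra.
  lra.
have -> : ((1 - q N.+1) * u + q N.+1 * v) / (lam N * c) =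
  u / lam N - q N.+1 * (2 * u / (lam N * c)) + q N.+1 * (v / (lam N * c)).
  by rewrite /c; field; split; apply: Rgt_not_eq => //; apply: Rplus_lt_le_0_compat; [apply: Rlt_0_1|].
by move: IH => /=; have := Rmult_le_compat_l _ _ _ Q0 key; lra.
Qed.

End Model.

(** * Window counts and their moments *)

Fixpoint sublists (n : seq nat) : seq (seq nat) :=
  if n is p :: n' then sublists n' ++ map (cons p) (sublists n') else [:: [::]].

Lemma size_sublists n : size (sublists n) = (2 ^ size n)%N.
Proof. by elim: n => //= p n IH; rewrite size_cat size_map IH expnS; lia. Qed.

Section Moments.
Variables (l : nat -> nat) (G : nat).
Hypothesis G_gt0 : (0 < G)%N.
Local Open Scope nat_scope.

Definition ell (d : seq nat) : nat := \sum_(p <- d) l p.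
Definition win (s w : nat) : bool := (s + G <= w) && (w < s + 2 * G).
Definition near (v w : nat) : bool := (v <= w + G) && (w <= v + G).

(* [cnt n w] counts the sublists [d] of [n] with [w - 2G < ell d <= w - G]; the
   shift by [G] keeps all the windows used below inside [nat]. *)
Definition cnt (n : seq nat) (w : nat) : nat :=
  count (fun d => win (ell d) w) (sublists n).
Definition cntsh (n : seq nat) (a w : nat) : nat :=
  count (fun d => win (a + ell d) w) (sublists n).
Definition range (n : seq nat) : nat := ell n + 2 * G.
Definition rawmom (j : nat) (n : seq nat) : nat :=
  \sum_(0 <= w < range n) cnt n w ^ j.
Definition rawcross (i k : nat) (n : seq nat) (a : nat) : nat :=
  \sum_(0 <= w < range n + a) cnt n w ^ i * cntsh n a w ^ k.
Definition mom (j : nat) (n : seq nat) : R := (INR (rawmom j n) / INR G)%R.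
Definition cross (i k : nat) (n : seq nat) (a : nat) : R :=
  (INR (rawcross i k n a) / INR G)%R.

Lemma ell_cons p n : ell (p :: n) = l p + ell n.
Proof. by rewrite /ell big_cons. Qed.

Lemma ell_sublists n d : d \in sublists n -> ell d <= ell n.
Proof.
elim: n d => [|p n IH] d /=; first by rewrite inE => /eqP ->.
rewrite ell_cons mem_cat => /orP[/IH|/mapP[d' /IH h ->]]; rewrite ?ell_cons; lia.
Qed.

Lemma cnt_cons p n w : cnt (p :: n) w = cnt n w + cntsh n (l p) w.
Proof.
rewrite /cnt /cntsh /= count_cat count_map; congr addn.
by apply: eq_count => d /=; rewrite ell_cons.
Qed.

Lemma cntsh_lt n a w : w < a -> cntsh n a w = 0.
Proof.
move=> wa; apply/eqP; rewrite eqn0Ngt -has_count -all_predC.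
by apply/allP => d _ /=; rewrite /win; lia.
Qed.

Lemma cntsh_addr n a w : cntsh n a (w + a) = cnt n w.
Proof. by apply: eq_count => d; rewrite /win; lia. Qed.

Lemma cnt_range n w : range n <= w -> cnt n w = 0.
Proof.
move=> h; apply/eqP; rewrite eqn0Ngt -has_count -all_predC.
by apply/allP => d /ell_sublists /=; move: h; rewrite /win /range; lia.
Qed.

Lemma cnt_ltG n w : w < G -> cnt n w = 0.
Proof.
move=> h; apply/eqP; rewrite eqn0Ngt -has_count -all_predC.
by apply/allP => d _ /=; rewrite /win; lia.
Qed.

Lemma cnt_le_size n w : cnt n w <= 2 ^ size n.
Proof. by rewrite -size_sublists count_size. Qed.

Lemma cnt_window n w w' : w' <= w <= w' + G -> cnt n w <= cnt n w' + cnt n (w' + G).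
Proof.
move=> h; rewrite /cnt -count_predUI.
apply: leq_trans (leq_addr _ _); apply: sub_count => d /=; rewrite /win; lia.
Qed.

Lemma sum_range n j (F : nat -> nat) W : 0 < j -> range n <= W ->
  \sum_(0 <= w < W) F w * cnt n w ^ j = \sum_(0 <= w < range n) F w * cnt n w ^ j.
Proof.
move=> j0 h; rewrite (@big_cat_nat _ _ _ (range n)) //= [X in _ + X]big1_seq ?addn0 // => w /=.
by rewrite mem_index_iota => /andP[hw _]; rewrite cnt_range // exp0n // muln0.
Qed.

Lemma rawmom_range n j W : 0 < j -> range n <= W ->
  \sum_(0 <= w < W) cnt n w ^ j = rawmom j n.
Proof.
move=> j0 h; have := sum_range (fun=> 1) j0 h.
by under eq_bigr do rewrite mul1n; under [in RHS]eq_bigr do rewrite mul1n.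
Qed.

Lemma sum_shift n a k (F : nat -> nat) W : 0 < k ->
  \sum_(0 <= w < W + a) F w * cntsh n a w ^ k =
  \sum_(0 <= v < W) F (v + a) * cnt n v ^ k.
Proof.
move=> k0; rewrite (@big_cat_nat _ _ _ a) //=; last by lia.
rewrite big1_seq ?add0n; last first.
  by move=> w /=; rewrite mem_index_iota => /andP[_ hw]; rewrite cntsh_lt // exp0n // muln0.
rewrite -{1}[a]add0n big_addn addnK; apply: eq_bigr => v _.
by rewrite cntsh_addr.
Qed.

(** Binomial expansion of the count plus its translate; by translation invariance both extreme terms
    equal [rawmom j n]. *)
Lemma rawmom_cons j p n : 0 < j ->
  rawmom j (p :: n) = 2 * rawmom j n
    + \sum_(1 <= i < j) 'C(j, i) * rawcross i (j - i) n (l p).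
Proof.
move=> j0; have rE : range (p :: n) = range n + l p.
  by rewrite /range ell_cons; lia.
rewrite {1}/rawmom rE.
under eq_bigr => w _ do rewrite cnt_cons addnC expnDn.
under eq_bigr => w _ do rewrite -(big_mkord xpredT (fun i =>
  'C(j, i) * (cntsh n (l p) w ^ (j - i) * cnt n w ^ i))) big_nat_recr //= big_ltn //.
rewrite !big_split /= addnAC; congr addn.
  rewrite mul2n -addnn; congr addn.
    transitivity (\sum_(0 <= w < range n + l p) 1 * cntsh n (l p) w ^ j).
      by apply: eq_bigr => w _; rewrite bin0 subn0 expn0 muln1.
    by rewrite (sum_shift _ _ (fun=> 1)) //; apply: eq_bigr => w _; rewrite mul1n.
  rewrite -(@rawmom_range n j (range n + l p)) ?leq_addr //.
  by apply: eq_bigr => w _; rewrite binn subnn expn0 !mul1n.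
rewrite exchange_big /=; apply: eq_bigr => i _; rewrite /rawcross big_distrr /=.
by apply: eq_bigr => w _; rewrite [X in _ * X]mulnC.
Qed.

(** Each sublist lies in exactly [G] windows, all of them below [range n]. *)
Lemma rawmom1 n : rawmom 1 n = G * 2 ^ size n.
Proof.
rewrite -size_sublists -sum1_size /rawmom.
under eq_bigr => w _ do rewrite expn1 /cnt -sum1_count big_mkcond.
rewrite exchange_big big_distrr /=; apply: eq_big_seq => d dn.
rewrite -big_mkcond /= sum1_count muln1.
have -> : index_iota 0 (range n) =
   index_iota 0 (ell d + G) ++ index_iota (ell d + G) (ell d + 2 * G) ++ index_iota (ell d + 2 * G) (range n).
  have := ell_sublists dn => h.
  rewrite /index_iota !subn0 -[X in X ++ (_ ++ _)]/(iota 0 (ell d + G)).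
  have -> : iota (ell d + G) (ell d + 2 * G - (ell d + G)) ++ iota (ell d + 2 * G) (range n - (ell d + 2 * G))
     = iota (ell d + G) (range n - (ell d + G)).
    have -> : range n - (ell d + G) = (ell d + 2 * G - (ell d + G)) + (range n - (ell d + 2 * G)).
      by rewrite /range; lia.
    by rewrite iotaD; congr (_ ++ iota _ _); lia.
  rewrite -{2}[ell d + G]add0n -iotaD; congr iota; rewrite /range; lia.
rewrite !count_cat.
have -> : count (win (ell d)) (index_iota 0 (ell d + G)) = 0.
  apply/eqP; rewrite eqn0Ngt -has_count -all_predC; apply/allP => w.
  by rewrite mem_index_iota /= /win; lia.
have -> : count (win (ell d)) (index_iota (ell d + 2 * G) (range n)) = 0.
  apply/eqP; rewrite eqn0Ngt -has_count -all_predC; apply/allP => w.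
  by rewrite mem_index_iota /= /win; lia.
rewrite (eq_in_count (a2 := xpredT)) ?count_predT ?size_iota; first lia.
by move=> w; rewrite mem_index_iota /win; lia.
Qed.

Lemma expn_add_le a b i : (a + b) ^ i <= 2 ^ i * (a ^ i + b ^ i).
Proof.
wlog ab : a b / a <= b.
  by move=> H; case/orP: (leq_total a b) => /H //; rewrite addnC [_ ^ i + _]addnC.
case: i => [|i]; first by rewrite !expn0.
apply: (@leq_trans ((2 * b) ^ i.+1)); first by rewrite leq_exp2r //; lia.
by rewrite expnMn leq_mul2l leq_addl orbT.
Qed.

(** For each of the [G] positions [v] in [(w - G, w]], the window at [w] is covered by those at [v]
    and [v + G]. Splitting the power costs [2 ^ i], and the positions [v] and [v + G] together fill
    [(w - G, w + G]] once. *)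
Lemma cnt_smooth n i w : 0 < i ->
  G * cnt n w ^ i <= 2 ^ i * \sum_(0 <= v < range n) near w v * cnt n v ^ i.
Proof.
move=> i0; case: (ltnP w G) => wG; first by rewrite cnt_ltG // exp0n // muln0.
rewrite -(@sum_range n i (fun v => near w v : nat) (w + G + 1 + range n)) //; last by lia.
apply: (@leq_trans (2 ^ i * \sum_(w - G + 1 <= v < w + G + 1) cnt n v ^ i)); last first.
  rewrite leq_mul2l; apply/orP; right.
  rewrite [X in _ <= X](@big_cat_nat _ _ _ (w - G + 1)) //=; last by lia.
  rewrite [X in _ <= _ + X](@big_cat_nat _ _ _ (w + G + 1)) //=; try by lia.
  rewrite addnCA; apply: leq_trans (leq_addr _ _).
  rewrite !big_seq; apply: leq_sum => v; rewrite mem_index_iota => h.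
  by rewrite (_ : near w v) ?mul1n // /near; lia.
rewrite (@big_cat_nat _ _ _ (w + 1)) /=; try by lia.
have -> : \sum_(w + 1 <= v < w + G + 1) cnt n v ^ i = \sum_(w - G + 1 <= v < w + 1) cnt n (v + G) ^ i.
  rewrite (_ : w + 1 = w - G + 1 + G); last by lia.
  rewrite big_addn; have -> : w + G + 1 - G = w - G + 1 + G by lia.
  by [].
rewrite -big_split big_distrr /=.
apply: (@leq_trans (\sum_(w - G + 1 <= v < w + 1) cnt n w ^ i)).
  rewrite sum_nat_const_nat; apply: eq_leq; congr muln; lia.
rewrite !big_seq; apply: leq_sum => v; rewrite mem_index_iota => h.
apply: leq_trans (expn_add_le _ _ _); rewrite leq_exp2r //.
apply: cnt_window; lia.
Qed.

(** Only the factor of smaller exponent is averaged, whence [2 ^ minn i k]. The translation [a] then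
    enters only through [near (v + a) w], so a sum over primes can be taken with both counts
    fixed. *)
Lemma cross_smooth n i k a : 0 < i -> 0 < k ->
  G * rawcross i k n a <= 2 ^ minn i k *
    \sum_(0 <= v < range n) \sum_(0 <= w < range n)
       near (v + a) w * (cnt n w ^ i * cnt n v ^ k).
Proof.
move=> i0 k0; rewrite /rawcross sum_shift // big_distrr /=.
case: (leqP i k) => ik.
  rewrite big_distrr /=; apply: leq_sum => v _.
  rewrite mulnA; apply: leq_trans (leq_mul (cnt_smooth _ _ i0) (leqnn _)) _.
  rewrite -mulnA leq_mul2l big_distrl /=; apply/orP; right; apply: leq_sum => w _.
  by rewrite mulnA.
apply: (@leq_trans (\sum_(0 <= v < range n) cnt n (v + a) ^ i *
   (2 ^ k * \sum_(0 <= v' < range n) near v v' * cnt n v' ^ k))).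
  by apply: leq_sum => v _; rewrite mulnCA leq_mul2l cnt_smooth // orbT.
under eq_bigr => v _ do rewrite mulnCA big_distrr /=.
rewrite -big_distrr leq_mul2l /=; apply/orP; right.
rewrite exchange_big /=; apply: leq_sum => v _.
apply: (@leq_trans (\sum_(0 <= w < range n + a) (near (v + a) w * cnt n v ^ k) * cnt n w ^ i)).
  rewrite [X in _ <= X](@big_cat_nat _ _ _ a) //=; last by lia.
  apply: leq_trans (leq_addl _ _).
  rewrite -{2}[a]add0n big_addn addnK; apply: leq_sum => w _.
  have -> : near (v + a) (w + a) = near w v by rewrite /near; lia.
  by rewrite mulnC.
rewrite sum_range //; last by lia.
by apply: leq_sum => w _; rewrite -mulnA [X in _ * X]mulnC.
Qed.

Local Open Scope R_scope.

Lemma INR_G_gt0 : 0 < INR G.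
Proof. by apply: lt_0_INR; apply/ltP. Qed.

Lemma mom_ge0 j n : 0 <= mom j n.
Proof. by apply: Rcomplements.Rdiv_le_0_compat; [apply: pos_INR|exact: INR_G_gt0]. Qed.

Lemma mom1 n : mom 1 n = 2 ^ size n.
Proof.
rewrite /mom rawmom1 INR_muln INR_expn (_ : INR 2 = 2) //; field.
by apply: Rgt_not_eq; apply: INR_G_gt0.
Qed.

Lemma mom_nil j : (0 < j)%N -> mom j [::] = 1.
Proof.
move=> j0; rewrite /mom (_ : rawmom j [::] = rawmom 1 [::]).
  rewrite rawmom1 muln1; field; apply: Rgt_not_eq; exact: INR_G_gt0.
apply: eq_bigr => w _; rewrite /cnt /= addn0 expn1.
by case: (win _ _); rewrite ?exp1n ?exp0n.
Qed.

Lemma mom_cons j p n : (0 < j)%N ->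
  mom j (p :: n) = 2 * mom j n + \sum_(1 <= i < j) (INR 'C(j, i) * cross i (j - i) n (l p)).
Proof.
move=> j0; rewrite /mom rawmom_cons // INR_addn INR_muln INR_sum Rdiv_plus_distr; congr (_ + _).
  by rewrite /=; lra.
rewrite /Rdiv big_distrl; apply: eq_bigr => i _; rewrite /cross INR_muln /=; lra.
Qed.

Lemma cross_ge0 i k n a : 0 <= cross i k n a.
Proof. by apply: Rcomplements.Rdiv_le_0_compat; [apply: pos_INR|exact: INR_G_gt0]. Qed.

Lemma cnt_le_mom j n w : (0 < j)%N -> INR (cnt n w) ^ j <= 2 ^ j * mom j n.
Proof.
move=> j0; have G0 := INR_G_gt0.
have h : (G * cnt n w ^ j <= 2 ^ j * rawmom j n)%N.
  apply: leq_trans (cnt_smooth _ _ j0) _; rewrite leq_mul2l; apply/orP; right.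
  by apply: leq_sum => v _; case: (near _ _); rewrite ?mul1n.
have := INR_leq h; rewrite !INR_muln !INR_expn (_ : INR 2 = 2) //.
have -> : mom j n = INR (rawmom j n) / INR G by [].
move=> {}h; apply: (Rmult_le_reg_l (INR G)) => //.
apply: Rle_trans h _; apply: Req_le; field; lra.
Qed.

(** For fixed [v] and [w] the sum over [p] is at most [H]; the double sum that remains is a product
    of two moments. *)
Lemma cross_sum (q : nat -> R) (r : seq nat) (H : R) n i k :
  (0 < i)%N -> (0 < k)%N -> (forall p, 0 <= q p) ->
  (forall v w, \sum_(p <- r | near (v + l p.+1) w) q p.+1 <= H) ->
  \sum_(p <- r) (q p.+1 * cross i k n (l p.+1)) <= H * 2 ^ minn i k * mom i n * mom k n.
Proof.
move=> i0 k0 q0 hH; have G0 := INR_G_gt0.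
pose Y v w := INR (cnt n w) ^ i * INR (cnt n v) ^ k.
pose N v w p := if near (v + l p.+1) w then 1 else 0.
have Y0 v w : 0 <= Y v w by apply: Rmult_le_pos; apply: pow_le; apply: pos_INR.
have hc p : cross i k n (l p.+1) <= 2 ^ minn i k / (INR G * INR G) *
   \sum_(0 <= v < range n) \sum_(0 <= w < range n) (N v w p * Y v w).
  have := INR_leq (cross_smooth n (l p.+1) i0 k0).
  rewrite !INR_muln INR_expn (_ : INR 2 = 2) // INR_sum.
  have -> : \sum_(0 <= v < range n) INR (\sum_(0 <= w < range n)
       near (v + l p.+1) w * (cnt n w ^ i * cnt n v ^ k))%N =
      \sum_(0 <= v < range n) \sum_(0 <= w < range n) (N v w p * Y v w).
    apply: eq_bigr => v _; rewrite INR_sum; apply: eq_bigr => w _.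
    by rewrite !INR_muln !INR_expn /N /Y; case: (near _ _).
  rewrite /cross; set a := INR (rawcross _ _ _ _); set b := \big[_/_]_(_ <= _ < _) _.
  move=> h; apply: (Rmult_le_reg_l (INR G * INR G)); first by apply: Rmult_lt_0_compat.
  have -> : INR G * INR G * (a / INR G) = INR G * a by field; lra.
  by have -> : INR G * INR G * (2 ^ minn i k / (INR G * INR G) * b) = 2 ^ minn i k * b by field; lra.
apply: (@Rle_trans _ (2 ^ minn i k / (INR G * INR G) *
   \sum_(p <- r) \sum_(0 <= v < range n) \sum_(0 <= w < range n) (Y v w * (N v w p * q p.+1)))).
  rewrite -sumR_mulr; apply: leR_sum => p _ _.
  apply: Rle_trans (Rmult_le_compat_l _ _ _ (q0 _) (hc p)) _.
  apply: Req_le; rewrite Rmult_comm Rmult_assoc; congr (_ * _).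
  rewrite -sumR_mull; apply: eq_bigr => v _; rewrite -sumR_mull; apply: eq_bigr => w _.
  by rewrite /=; lra.
have -> : H * 2 ^ minn i k * mom i n * mom k n = 2 ^ minn i k / (INR G * INR G) *
    (INR (rawmom k n) * (INR (rawmom i n) * H)) by rewrite /mom; field; lra.
apply: Rmult_le_compat_l.
  apply: Rcomplements.Rdiv_le_0_compat; [apply: pow_le; lra|exact: Rmult_lt_0_compat].
rewrite exchange_big /rawmom !INR_sum -sumR_mull; apply: leR_sum => v _ _.
rewrite exchange_big /= -Rmult_assoc -sumR_mulr -sumR_mull; apply: leR_sum => w _ _.
rewrite sumR_mulr !INR_expn [_ * INR (cnt n w) ^ i]Rmult_comm -/(Y v w).
apply: Rmult_le_compat_l => //; rewrite -sumR_cond; exact: hH.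
Qed.

End Moments.

(** * The stopped moments *)

Definition Rleb (x y : R) : bool := if Rle_dec x y then true else false.

Lemma RlebP x y : reflect (x <= y) (Rleb x y).
Proof. by rewrite /Rleb; case: Rle_dec => h; constructor. Qed.

Lemma sqrt2_bounds : 1.414 <= sqrt 2 <= 1.4143.
Proof.
have h : sqrt 2 * sqrt 2 = 2 by apply: sqrt_sqrt; lra.
have h0 := sqrt_pos 2; split; nra.
Qed.

(** Without source, this compares one step of the mean of [mom * psi]: an insertion doubles the
    moment and divides [psi] by [sqrt 2], while [psi] loses [sqrt (1 + q)] in any case. *)
Lemma decay_ineq q : 0 <= q <= 1 / 3 -> 1 - q + sqrt 2 * q <= (1 - q / 25) * sqrt (1 + q).
Proof.
move=> hq; have [s1 s2] := sqrt2_bounds.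
have h : sqrt (1 + q) * sqrt (1 + q) = 1 + q by apply: sqrt_sqrt; lra.
have h0 := sqrt_pos (1 + q).
apply: (@Rle_trans _ (1 + 0.4143 * q)); first nra.
apply: Rsqr_incr_0_var; last by nra.
rewrite /Rsqr (_ : _ * sqrt _ * (_ * _) = (1 - q / 25) * (1 - q / 25) * (sqrt (1 + q) * sqrt (1 + q))); last by lra.
rewrite h; nra.
Qed.

(** The opposite direction for [(tau / lam) ^ (3 / 2)]: an insertion multiplies [tau ^ (3 / 2)] by
    [2 * sqrt 2], so without stopping the mean grows by at least [1 + q / 10]. *)
Lemma growth_ineq q : 0 <= q <= 1 / 3 ->
  (1 + q / 10) * ((1 + q) * sqrt (1 + q)) <= 1 - q + 2 * sqrt 2 * q.
Proof.
move=> hq; have [s1 s2] := sqrt2_bounds.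
have h : sqrt (1 + q) * sqrt (1 + q) = 1 + q by apply: sqrt_sqrt; lra.
have h0 := sqrt_pos (1 + q).
apply: (@Rle_trans _ (1 + 1.828 * q)); last by nra.
apply: Rsqr_incr_0_var; last by nra.
rewrite /Rsqr (_ : (1 + q / 10) * _ * (_ * _) =
  (1 + q / 10) * (1 + q / 10) * ((1 + q) * (1 + q)) * (sqrt (1 + q) * sqrt (1 + q))); last by lra.
rewrite h.
(* The factored difference of the squares of the two sides; 1.828 is [2 * 1.414 - 1]. *)
have : 0 <= q * (0.456 - 0.268416 * q - 1.63 * (q * q) - 0.23 * (q * (q * q)) - 0.01 * (q * q * (q * q))).
  apply: Rmult_le_pos; first lra.
  have q2 : q * q <= q / 3 by nra.
  have q20 : 0 <= q * q by nra.
  have q3 : q * (q * q) <= q / 9 by nra.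
  have q4 : q * q * (q * q) <= q / 27 by nra.
  lra.
lra.
Qed.

Section Main.
Variables (q : nat -> R) (l : nat -> nat) (G : nat) (B : R).
Hypothesis q_ge0 : forall p, 0 <= q p.
Hypothesis q_le : forall p, q p <= 1 / 3.
Hypothesis G_gt0 : (0 < G)%N.
Hypothesis B_ge1 : 1 <= B.
Hypothesis q_window : forall m N v w,
  \sum_(m <= p < N | near G (v + l p.+1) w) q p.+1 <= B / lam q m.
Variables (c : nat -> R) (A : R) (Q N : nat).
Hypothesis c1 : c 1%N = 1.
Hypothesis c_ge : forall j, (1 < j)%N -> 10000 * B <= c j.
(** The base [12 / 5] is [2 * (6 / 5)]: 2 from the smoothing of the cross moments, [6 / 5] from the
    thresholds [thr]. *)
Hypothesis c_conv : forall j, (1 < j)%N ->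
  \sum_(1 <= i < j) (INR 'C(j, i) * (12 / 5) ^ minn i (j - i) * c i * c (j - i)%N)
  <= c j / (10000 * B).
Hypothesis A_ge1 : 1 <= A.

Local Notation lam := (lam q).
Local Notation Ex := (Ex q).
Local Notation births := (births q).
Local Notation total := (total q).
Local Notation mom := (mom l G).
Local Notation cross := (cross l G).
Local Notation hd := (head 0%N).
Let tau (n : seq nat) : R := 2 ^ size n.
Let lam_gt0 := lam_gt0 q_ge0.

(** The factor [(6 / 5) ^ j.-1] is slack that makes the probabilities of stopping on account of
    order [j] summable over [j]. *)
Definition thr (j : nat) : R := A ^ j * c j * (6 / 5) ^ j.-1.

(* Since [lam] is nondecreasing, the moments need testing only just after insertions. *)
Definition okb (n : seq nat) : bool :=
  all (fun j => Rleb (mom j n) (thr j * lam (hd n))) (iota 1 Q).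

Fixpoint good (n : seq nat) : bool :=
  if n is _ :: n' then good n' && okb n else true.

Definition gd (n : seq nat) : R := if good n then 1 else 0.

(* The weight [psi] is at least [1 / lam m] on good lists, and multiplies by
   [1 / sqrt 2] at each insertion: this makes [tau * psi] decay in mean. *)
Definition psi (n : seq nat) (m : nat) : R := sqrt (A / (tau n * lam m)).

Definition source (j p : nat) (n : seq nat) : R :=
  \sum_(1 <= i < j) (INR 'C(j, i) * cross i (j - i) n (l p)).

Lemma gd_ge0 n : 0 <= gd n. Proof. by rewrite /gd; case: good; lra. Qed.

Lemma gd_le p n : 0 <= gd n - gd (p :: n).
Proof. by rewrite /gd /=; case: good => /=; [case: okb; lra|lra]. Qed.

Lemma gd_cons_le p n : gd (p :: n) <= gd n.
Proof. by have := gd_le p n; lra. Qed.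

Lemma tau_gt0 n : 0 < tau n. Proof. by apply: pow_lt; lra. Qed.

Lemma tau_cons p n : tau (p :: n) = 2 * tau n. Proof. by []. Qed.

Lemma c_ge1 j : (0 < j)%N -> 1 <= c j.
Proof.
case: j => [|[|j]] // _; first by rewrite c1; lra.
by have := @c_ge j.+2 isT; lra.
Qed.

Lemma source_ge0 j p n : 0 <= source j p n.
Proof.
apply: sumR_ge0 => i _ _; apply: Rmult_le_pos; first exact: pos_INR.
exact: cross_ge0.
Qed.

Lemma powA_ge1 j : 1 <= A ^ j. Proof. exact: pow_R1_Rle. Qed.

Lemma thr_ge1 j : (0 < j)%N -> 1 <= thr j.
Proof.
move=> /c_ge1 hc; rewrite /thr.
have h : 1 <= (6 / 5) ^ j.-1 by apply: pow_R1_Rle; lra.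
have hA := powA_ge1 j; have h2 : 1 <= A ^ j * c j by nra.
nra.
Qed.

Lemma good_mom n j : good n -> (0 < j <= Q)%N -> mom j n <= thr j * lam (hd n).
Proof.
move=> gn hj; suff /allP h : okb n by apply/RlebP/h; rewrite mem_iota; lia.
case: n gn => [|p n] /=; last by case/andP.
move=> _; apply/allP => i; rewrite mem_iota => hi; apply/RlebP; rewrite mom_nil //=; last lia.
by have := @thr_ge1 i; rewrite Rmult_1_r; apply; lia.
Qed.

Hypothesis Q_gt0 : (0 < Q)%N.

Lemma good_tau n : good n -> tau n <= A * lam (hd n).
Proof.
move=> /(@good_mom _ 1%N); rewrite mom1 // /thr c1 /= => /(_ Q_gt0).
by rewrite !Rmult_1_r.
Qed.

Lemma psi_pos n m : 0 < psi n m.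
Proof.
apply: sqrt_lt_R0; apply: Rdiv_lt_0_compat; first lra.
by apply: Rmult_lt_0_compat; [exact: tau_gt0|exact: lam_gt0].
Qed.

Lemma psi_lower n m : tau n <= A * lam m -> 1 / lam m <= psi n m.
Proof.
move=> h; have t0 := tau_gt0 n; have l0 := lam_gt0 m.
rewrite -[1 / _]sqrt_Rsqr; last by apply: Rlt_le; apply: Rdiv_lt_0_compat; lra.
apply: sqrt_le_1_alt; rewrite /Rsqr.
apply: (Rmult_le_reg_l (tau n * (lam m * lam m))); first by do !apply: Rmult_lt_0_compat.
have -> : tau n * (lam m * lam m) * (1 / lam m * (1 / lam m)) = tau n by field; lra.
by have -> : tau n * (lam m * lam m) * (A / (tau n * lam m)) = A * lam m by field; lra.
Qed.

Lemma psi_le n m m' : (m <= m')%N -> psi n m' <= psi n m.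
Proof.
move=> /(lam_le q_ge0) h; have t0 := tau_gt0 n; have l0 := lam_gt0 m.
apply: sqrt_le_1_alt; apply: Rmult_le_compat_l; first lra.
by apply: Rinv_le_contravar; [exact: Rmult_lt_0_compat|apply: Rmult_le_compat_l; lra].
Qed.

Lemma psi_step n m : psi n m = sqrt (1 + q m.+1) * psi n m.+1.
Proof.
have t0 := tau_gt0 n; have l0 := lam_gt0 m; have := q_ge0 m.+1 => q0.
rewrite /psi -sqrt_mult_alt; last by lra.
congr sqrt; rewrite /=; field; repeat split; lra.
Qed.

Lemma psi_cons p n m : psi n m = sqrt 2 * psi (p :: n) m.
Proof.
have t0 := tau_gt0 n; have l0 := lam_gt0 m.
rewrite /psi -sqrt_mult_alt; last by lra.
congr sqrt; rewrite tau_cons; field; lra.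
Qed.

Definition Phi j m := Ex m (fun n => gd n * mom j n * psi n m).
Definition src j := total N (fun p n => gd n * source j p n * psi n p.-1).
Definition wbirths j := births N (fun n => gd n * mom j n * psi n (hd n)).

Lemma mom_source j p n : (0 < j)%N -> mom j (p :: n) = 2 * mom j n + source j p n.
Proof. exact: mom_cons. Qed.

Lemma Phi_step j m : (0 < j)%N ->
  Phi j m.+1 <= (1 - q m.+1 / 25) * Phi j m
    + q m.+1 * Ex m (fun n => gd n * source j m.+1 n * psi n m).
Proof.
move=> j0; rewrite /Phi /=; have q0 := q_ge0 m.+1; have q1 := q_le m.+1.
have di := decay_ineq (conj q0 q1); have [s21 s22] := sqrt2_bounds.
have s0 : 1 <= sqrt (1 + q m.+1) by rewrite -{1}sqrt_1; apply: sqrt_le_1_alt; lra.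
rewrite -!ExZ -!ExD; apply: Ex_le => // n _; cbv beta.
rewrite mom_source // (psi_step n m) (psi_cons m.+1 n m.+1).
have G0 := gd_ge0 n; have G1 := gd_cons_le m.+1 n; have G2 := gd_ge0 (m.+1 :: n).
have P0 := psi_pos (m.+1 :: n) m.+1; have M0 := mom_ge0 l G_gt0 j n.
have S0 := source_ge0 j m.+1 n.
move: (psi _ _) (mom _ _) (source _ _ _) (gd (_ :: _)) (gd n) (q m.+1) (sqrt (1 + q m.+1)) G0 G1 G2 P0 M0 S0 di s0 q0 q1
  => P M S g' g x s G0 G1 G2 P0 M0 S0 di s0 q0 q1.
have h2 : sqrt 2 * sqrt 2 = 2 by apply: sqrt_sqrt; lra.
move: (sqrt 2) h2 s21 s22 di => u h2 s21 s22 di.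
apply: (@Rle_trans _ ((1 - x) * (g * M * (u * P)) + x * (g * (2 * M + S) * P))).
  apply: Rplus_le_compat_l; apply: Rmult_le_compat_l => //.
  apply: Rmult_le_compat_r; first lra.
  apply: Rmult_le_compat_r; lra.
have e1 : 0 <= (((1 - x / 25) * s) - (1 - x + u * x)) * (g * M * u * P).
  apply: Rmult_le_pos; first lra; do !apply: Rmult_le_pos; lra.
have e2 : 0 <= (s * u - 1) * (x * g * S * P).
  apply: Rmult_le_pos; first nra; do !apply: Rmult_le_pos; lra.
have e3 : x * g * M * P * (u * u) = x * g * M * P * 2 by rewrite h2.
lra.
Qed.

(** Telescoping of [Phi_step]: the initial value [sqrt A] and the sources pay for the loss of
    [q * Phi / 25] at every step. *)
Lemma Phi_total j : (0 < j)%N ->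
  \sum_(0 <= p < N) (q p.+1 * Phi j p) <= 25 * (sqrt A + src j).
Proof.
move=> j0.
suff h : (\sum_(0 <= p < N) (q p.+1 * Phi j p)) / 25 + Phi j N <= sqrt A + src j.
  have : 0 <= Phi j N.
    apply: Ex_ge0 => // n _; apply: Rmult_le_pos; last exact/Rlt_le/psi_pos.
    by apply: Rmult_le_pos; [exact: gd_ge0|exact: mom_ge0].
  lra.
rewrite /src /total /=; elim: N => [|m IH].
  rewrite !big_nil /Phi /= mom_nil // /gd /psi /tau /= !Rmult_1_r /Rdiv Rinv_1 !Rmult_1_r; lra.
rewrite !big_nat_recr //=; have := Phi_step m j0; lra.
Qed.

(** A new list has moment [2 * mom j n + source] and a weight no larger than before the insertion.
    This gives twice the 25 of [Phi_total], plus 1 for the empty list and for the source itself. *)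
Lemma wbirths_src j : (0 < j)%N -> wbirths j <= 51 * (sqrt A + src j).
Proof.
move=> j0; rewrite /wbirths birthsE /=.
have -> : gd [::] * mom j [::] * psi [::] 0 = sqrt A.
  by rewrite mom_nil // /gd /psi /tau /= !Rmult_1_r /Rdiv Rinv_1 Rmult_1_l Rmult_1_r.
suff : total N (fun p n => gd (p :: n) * mom j (p :: n) * psi (p :: n) p) <=
       2 * (\sum_(0 <= p < N) (q p.+1 * Phi j p)) + src j.
  by have := Phi_total j0; lra.
have -> : 2 * (\sum_(0 <= p < N) (q p.+1 * Phi j p)) =
   total N (fun p n => 2 * (gd n * mom j n * psi n p.-1)) by rewrite totalZ.
rewrite -totalD; apply: total_le => // p n _ _ /=.
rewrite mom_source //.
have P1 : psi (p.+1 :: n) p.+1 <= psi n p.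
  apply: Rle_trans (psi_le _ (leqnSn p)) _; rewrite (psi_cons p.+1 n p).
  by have := sqrt2_bounds; have := psi_pos (p.+1 :: n) p; nra.
have := psi_pos (p.+1 :: n) p.+1; have M0 := mom_ge0 l G_gt0 j n.
have S0 := source_ge0 j p.+1 n; have G1 := gd_cons_le p.+1 n; have G2 := gd_ge0 (p.+1 :: n).
move=> P0.
apply: (@Rle_trans _ (gd n * (2 * mom j n + source j p.+1 n) * psi n p)); last by lra.
apply: Rmult_le_compat; try lra; first by apply: Rmult_le_pos; lra.
by apply: Rmult_le_compat_r; lra.
Qed.

(** As [psi] is nonincreasing in the stage, it can be frozen at the last insertion; [cross_sum] then
    applies to the later insertions with [H = B / lam (hd n)]. *)
Lemma src_le j : src j <= B * \sum_(1 <= i < j) (INR 'C(j, i) * 2 ^ minn i (j - i) *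
   births N (fun n => gd n * psi n (hd n) * mom i n * mom (j - i) n / lam (hd n))).
Proof.
rewrite /src; apply: Rle_trans (total_births q_ge0 q_le _ _) _.
  move=> p n; apply: Rmult_le_pos; last exact/Rlt_le/psi_pos.
  by apply: Rmult_le_pos; [exact: gd_ge0|exact: source_ge0].
rewrite -sumR_mulr.
under [X in _ <= X]eq_bigr do rewrite -birthsZ -birthsZ.
rewrite -(births_sum q_ge0 q_le); apply: (births_le q_ge0 q_le) => n _ /=.
have G0 := gd_ge0 n; have P0 := psi_pos n (hd n).
apply: (@Rle_trans _ (gd n * psi n (hd n) * \sum_(hd n <= p < N) (q p.+1 * source j p.+1 n))).
  rewrite -sumR_mulr; apply: leR_sum => p; rewrite mem_index_iota => /andP[hp _] _.
  have := psi_le n hp; have S0 := source_ge0 j p.+1 n; have q0 := q_ge0 p.+1 => h.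
  have : 0 <= (psi n (hd n) - psi n p) * (q p.+1 * (gd n * source j p.+1 n)).
    by apply: Rmult_le_pos; [lra|do !apply: Rmult_le_pos].
  lra.
have -> : \sum_(hd n <= p < N) (q p.+1 * source j p.+1 n) =
   \sum_(1 <= i < j) (INR 'C(j, i) * \sum_(hd n <= p < N) (q p.+1 * cross i (j - i) n (l p.+1))).
  rewrite /source; under eq_bigr do rewrite -sumR_mulr.
  rewrite exchange_big /=; apply: eq_bigr => i _; rewrite -sumR_mulr.
  by apply: eq_bigr => p _; lra.
rewrite -sumR_mulr; apply: leR_sum => i; rewrite mem_index_iota => hi _.
have h := @cross_sum l G G_gt0 q (index_iota (hd n) N) (B / lam (hd n)) n i (j - i).
have {}h := h _ _ q_ge0 (q_window (hd n) N); have {}h := h ltac:(lia) ltac:(lia).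
have C0 := pos_INR 'C(j, i).
have : 0 <= gd n * psi n (hd n) * INR 'C(j, i) by do !apply: Rmult_le_pos; lra.
move=> /Rmult_le_compat_l /(_ h); rewrite /Rdiv; lra.
Qed.

(** * The second moment *)

Let r32 (x : R) : R := x * sqrt x.
(* Without the stopping, [V] grows like a power of [lam m]: this bounds the total of its
   stopped version by its exits. It serves for the moment of order 2, where the bound
   used for the higher orders would lose a factor [sqrt A]. *)
Definition V m := Ex m (fun n => gd n * r32 (tau n / lam m)).

Lemma r32M x y : 0 <= x -> 0 <= y -> r32 (x * y) = r32 x * r32 y.
Proof. by move=> x0 y0; rewrite /r32 sqrt_mult //; lra. Qed.

Lemma r32_ge0 x : 0 <= x -> 0 <= r32 x.
Proof. by move=> x0; apply: Rmult_le_pos => //; exact: sqrt_pos. Qed.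

Lemma r32_le x y : 0 <= x <= y -> r32 x <= r32 y.
Proof.
move=> [x0 xy]; apply: Rmult_le_compat => //; first exact: sqrt_pos.
exact: sqrt_le_1_alt.
Qed.

Lemma ratio_ge0 n m : 0 <= tau n / lam m.
Proof. by apply: Rlt_le; apply: Rdiv_lt_0_compat; [exact: tau_gt0|]. Qed.

Lemma good_tau_path n m : good n -> path gtn m.+1 n -> tau n / lam m <= A.
Proof.
move=> gn pn; apply: (Rmult_le_reg_r (lam m)) => //.
have -> : tau n / lam m * lam m = tau n by field; have := lam_gt0 m; lra.
apply: Rle_trans (good_tau gn) _; apply: Rmult_le_compat_l; first lra.
by apply: lam_le => //; case: n pn {gn} => //= p n /andP[].
Qed.

(** An instance of [flux] with source 0, since [tau] exactly doubles. *)
Lemma tau_flux :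
  total N (fun p n => (gd n - gd (p :: n)) * tau (p :: n) / lam p)
    + Ex N (fun n => gd n * tau n) / lam N <= 1.
Proof.
apply: Rle_trans (flux (S := fun _ _ => 0) q_ge0 q_le N gd_ge0 _) _.
  by move=> p n; rewrite tau_cons; lra.
have -> : total N (fun p n => gd n * 0 / lam p) = 0.
  rewrite /total big1 // => p _; rewrite -[Ex _ _]/(Ex p (fun n => gd n * 0 / lam p.+1)).
  rewrite (@Ex_ext q q_ge0 q_le p _ (fun=> 0)) ?Ex_const; first lra.
  by move=> n _; lra.
rewrite /gd /tau /=; lra.
Qed.

(** The growth is [growth_ineq], up to exits. At an exit the parent is good, so the new [tau / lam]
    is at most [2 * A], and the [r32] lost is at most [sqrt (2 * A)] times the [tau / lam] lost,
    whose total is controlled by [tau_flux]. *)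
Lemma V_step m :
  (1 + q m.+1 / 10) * V m <= V m.+1 + q m.+1 * (sqrt (2 * A) *
      Ex m (fun n => (gd n - gd (m.+1 :: n)) * tau (m.+1 :: n) / lam m.+1)).
Proof.
rewrite /V [Ex m.+1 _]/=; have q0 := q_ge0 m.+1; have q1 := q_le m.+1.
have gi := growth_ineq (conj q0 q1).
have l0 := lam_gt0 m.
rewrite -!ExZ -!ExD; apply: Ex_le => // n pn; cbv beta.
rewrite !tau_cons -[_ * (1 + _)]/(lam m.+1).
have L1 : lam m.+1 = lam m * (1 + q m.+1) by [].
have G1 := gd_le m.+1 n; have G2 := gd_ge0 (m.+1 :: n).
have t0 := ratio_ge0 n m.
have q2 : 0 <= / (1 + q m.+1) by apply: Rlt_le; apply: Rinv_0_lt_compat; lra.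
have e1 : tau n / lam m.+1 = tau n / lam m * / (1 + q m.+1).
  by rewrite L1; field; split; apply: Rgt_not_eq; lra.
have e2 : 2 * tau n / lam m.+1 = 2 * (tau n / lam m * / (1 + q m.+1)).
  by rewrite -e1; lra.
have x0 : 0 <= tau n / lam m * / (1 + q m.+1) by apply: Rmult_le_pos.
have e3 : r32 2 = 2 * sqrt 2 by [].
have e4 : 1 + q m.+1 / 10 <= (1 - q m.+1 + 2 * sqrt 2 * q m.+1) * r32 (/ (1 + q m.+1)).
  have s0 : 0 < sqrt (1 + q m.+1) by apply: sqrt_lt_R0; lra.
  have p0 : 0 < (1 + q m.+1) * sqrt (1 + q m.+1) by apply: Rmult_lt_0_compat; lra.
  apply: (Rmult_le_reg_r ((1 + q m.+1) * sqrt (1 + q m.+1))) => //.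
  apply: Rle_trans gi _; apply: Req_le.
  rewrite /r32 sqrt_inv; field; lra.
have exit : (gd n - gd (m.+1 :: n)) * r32 (2 * tau n / lam m.+1) <=
   sqrt (2 * A) * ((gd n - gd (m.+1 :: n)) * (2 * tau n) / lam m.+1).
  case: (boolP (good n)) => gn; last first.
    by rewrite /gd /= (negbTE gn) /=; lra.
  have h : 2 * tau n / lam m.+1 <= 2 * A.
    rewrite e2; apply: Rmult_le_compat_l; first lra.
    apply: Rle_trans (good_tau_path gn pn).
    rewrite -{2}[tau n / lam m]Rmult_1_r; apply: Rmult_le_compat_l => //.
    by rewrite -Rinv_1; apply: Rinv_le_contravar; lra.
  have y0 : 0 <= 2 * tau n / lam m.+1 by rewrite e2; lra.
  have := sqrt_le_1_alt _ _ h => hs; rewrite /r32.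
  have : 0 <= (sqrt (2 * A) - sqrt (2 * tau n / lam m.+1)) *
      ((gd n - gd (m.+1 :: n)) * (2 * tau n / lam m.+1)).
    by apply: Rmult_le_pos; [lra|apply: Rmult_le_pos].
  by rewrite /Rdiv; lra.
rewrite e2 e1 in exit *; rewrite r32M in exit *; try lra.
rewrite e3 in exit *; rewrite r32M in exit *; try lra.
have := Rmult_le_compat_l _ _ _ q0 exit => {}exit.
have g0 := gd_ge0 n; have r0 := r32_ge0 t0.
have : 0 <= ((1 - q m.+1 + 2 * sqrt 2 * q m.+1) * r32 (/ (1 + q m.+1)) - (1 + q m.+1 / 10))
   * (gd n * r32 (tau n / lam m)).
  by apply: Rmult_le_pos; [lra|exact: Rmult_le_pos].
rewrite -/(lam m.+1); lra.
Qed.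

(** Telescoping leaves the final value and the exits, each at most [sqrt (2 * A)] times the
    corresponding term of [tau_flux]. *)
Lemma V_total : \sum_(0 <= p < N) (q p.+1 * V p) <= 10 * sqrt (2 * A).
Proof.
have sA := sqrt_pos (2 * A).
suff h : (\sum_(0 <= p < N) (q p.+1 * V p)) / 10 <= V N + sqrt (2 * A) *
   total N (fun p n => (gd n - gd (p :: n)) * tau (p :: n) / lam p).
  have : V N <= sqrt (2 * A) * (Ex N (fun n => gd n * tau n) / lam N).
    rewrite /Rdiv [Ex _ _ * _]Rmult_comm -!ExZ; apply: Ex_le => // n pn; cbv beta.
    case: (boolP (good n)) => gn; last first.
      by rewrite /gd (negbTE gn) /=; lra.
    have h1 := good_tau_path gn pn; have h2 := ratio_ge0 n N.
    have h3 : sqrt (tau n / lam N) <= sqrt (2 * A) by apply: sqrt_le_1_alt; lra.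
    rewrite /r32; have := gd_ge0 n => g0.
    have : 0 <= (sqrt (2 * A) - sqrt (tau n / lam N)) * (gd n * (tau n / lam N)).
      by apply: Rmult_le_pos; [lra|apply: Rmult_le_pos].
    by rewrite /Rdiv; lra.
  have := Rmult_le_compat_l _ _ _ sA tau_flux; lra.
rewrite /total; elim: N => [|m IH].
  rewrite !big_nil Rmult_0_r; have : 0 <= V 0 by apply: Rmult_le_pos; [exact: gd_ge0|exact/r32_ge0/ratio_ge0].
  lra.
rewrite !big_nat_recr //=; have := V_step m; rewrite /=; move: IH => /=; lra.
Qed.

(** A new list has at most [r32 2 = 2 * sqrt 2] times the value of its parent; with [V_total] this
    gives [40 * sqrt A], and the empty list adds 1. *)
Lemma births_r32 : births N (fun n => gd n * r32 (tau n / lam (hd n))) <= 41 * sqrt A.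
Proof.
rewrite birthsE /=.
have -> : gd [::] * r32 (tau [::] / 1) = 1.
  by rewrite /gd /r32 /tau /= /Rdiv Rinv_1 Rmult_1_r sqrt_1; lra.
have s1 : 1 <= sqrt A by rewrite -{1}sqrt_1; apply: sqrt_le_1_alt.
suff : total N (fun p n => gd (p :: n) * r32 (tau (p :: n) / lam p)) <=
   2 * sqrt 2 * \sum_(0 <= p < N) (q p.+1 * V p).
  have := V_total; rewrite sqrt_mult; [|lra|lra].
  have h2 : sqrt 2 * sqrt 2 = 2 by apply: sqrt_sqrt; lra.
  have := sqrt_pos 2 => s2 hV; have := Rmult_le_compat_l (2 * sqrt 2) _ _ ltac:(lra) hV.
  have -> : 2 * sqrt 2 * (10 * (sqrt 2 * sqrt A)) = 20 * (sqrt 2 * sqrt 2) * sqrt A by lra.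
  by rewrite h2; lra.
have -> : 2 * sqrt 2 * \sum_(0 <= p < N) (q p.+1 * V p) =
   total N (fun p n => 2 * sqrt 2 * (gd n * r32 (tau n / lam p.-1))) by rewrite totalZ.
apply: total_le => // p n _ _; rewrite tau_cons /=.
have e : r32 (2 * tau n / (lam p * (1 + q p.+1))) <= 2 * sqrt 2 * r32 (tau n / lam p).
  rewrite -[2 * sqrt 2]/(r32 2) -r32M; [|lra|exact: ratio_ge0].
  have l0 := lam_gt0 p; have t0 := tau_gt0 n; have q0 := q_ge0 p.+1.
  apply: r32_le; split.
    by apply: Rlt_le; apply: Rdiv_lt_0_compat; [lra|apply: Rmult_lt_0_compat; lra].
  rewrite /Rdiv -Rmult_assoc; apply: Rmult_le_compat_l; first lra.
  by apply: Rinv_le_contravar => //; nra.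
have := gd_cons_le p.+1 n; have := gd_ge0 (p.+1 :: n).
have := r32_ge0 (ratio_ge0 n p); have := sqrt_pos 2.
move=> s0 r0 g0 g1.
apply: Rle_trans (Rmult_le_compat_l _ _ _ g0 e) _.
have : 0 <= (gd n - gd (p.+1 :: n)) * (2 * sqrt 2 * r32 (tau n / lam p)).
  by apply: Rmult_le_pos; [lra|apply: Rmult_le_pos; lra].
lra.
Qed.

Lemma psi_r32 n m : gd n * psi n m * tau n * tau n / lam m = sqrt A * (gd n * r32 (tau n / lam m)).
Proof.
have l0 := lam_gt0 m; have t0 := tau_gt0 n.
have h : psi n m * tau n = sqrt A * sqrt (tau n / lam m).
  rewrite -{1}(sqrt_Rsqr (tau n)); last lra.
  rewrite /psi -sqrt_mult_alt; last first.
    by apply: Rlt_le; apply: Rdiv_lt_0_compat; [lra|exact: Rmult_lt_0_compat].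
  rewrite -sqrt_mult_alt; last lra.
  by congr sqrt; rewrite /Rsqr; field; lra.
rewrite /r32; have -> : gd n * psi n m * tau n * tau n / lam m =
  gd n * (psi n m * tau n) * tau n / lam m by field; lra.
rewrite h; field; lra.
Qed.

Lemma src2_le : src 2 <= 164 * B * A.
Proof.
apply: Rle_trans (src_le 2) _; rewrite big_nat1 (_ : minn 1 (2 - 1) = 1%N) //.
have -> : births N (fun n => gd n * psi n (hd n) * mom 1 n * mom (2 - 1) n / lam (hd n)) =
  sqrt A * births N (fun n => gd n * r32 (tau n / lam (hd n))).
  rewrite -birthsZ; apply: (births_ext q_ge0 q_le) => n _.
  by rewrite !mom1 // -/(tau n) psi_r32.
have := births_r32; have sA := sqrt_pos A.
move=> /(Rmult_le_compat_l _ _ _ sA).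
have hA : sqrt A * sqrt A = A by apply: sqrt_sqrt; lra.
have -> : sqrt A * (41 * sqrt A) = 41 * A by rewrite -{3}hA; lra.
rewrite (_ : 'C(2, 1) = 2%N) // => h.
have -> : 164 * B * A = B * (INR 2 * (2 * 1) * (41 * A)) by rewrite /=; lra.
apply: Rmult_le_compat_l; first lra.
by apply: Rmult_le_compat_l; rewrite /=; lra.
Qed.

(** * Higher moments, by induction on the order *)

Lemma births_pair i k : (0 < i <= Q)%N -> 
  births N (fun n => gd n * psi n (hd n) * mom i n * mom k n / lam (hd n)) <= thr i * wbirths k.
Proof.
move=> hi; rewrite /wbirths -birthsZ; apply: (births_le q_ge0 q_le) => n _.
have l0 := lam_gt0 (hd n); have P0 := psi_pos n (hd n); have M0 := mom_ge0 l G_gt0 k n.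
rewrite /gd; case: (boolP (good n)) => gn; last lra.
have h := good_mom gn hi.
apply: (Rmult_le_reg_r (lam (hd n))) => //.
have -> : 1 * psi n (hd n) * mom i n * mom k n / lam (hd n) * lam (hd n) =
  psi n (hd n) * mom k n * mom i n by field; lra.
have -> : thr i * (1 * mom k n * psi n (hd n)) * lam (hd n) =
  psi n (hd n) * mom k n * (thr i * lam (hd n)) by lra.
apply: Rmult_le_compat_l => //; apply: Rmult_le_pos; lra.
Qed.

Lemma thr_pow i k : (0 < i)%N -> (0 < k)%N -> 
  thr i * (A ^ k.-1 * c k) <= A ^ (i + k).-1 * ((6 / 5) ^ i * c i * c k).
Proof.
case: i => [|i] // _; case: k => [|k] // _; rewrite /thr addnS /= pow_add /=.
have hA := powA_ge1 i; have hA' := powA_ge1 k.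
have ci := @c_ge1 i.+1 isT; have ck := @c_ge1 k.+1 isT.
have r0 : 0 < (6 / 5) ^ i by apply: pow_lt; lra.
have : 0 <= A * A ^ i * A ^ k * (6 / 5) ^ i * c i.+1 * c k.+1 by do !apply: Rmult_le_pos; lra.
lra.
Qed.

(** The threshold is used for the smaller of [i] and [j - i], the induction hypothesis for the
    larger. Since [j > 2] the larger one exceeds 1, as it must: [wbirths 1] is at least [sqrt A],
    whereas [A ^ 0 * c 1 = 1]. *)
Lemma src_pair j i : (2 < j <= Q)%N -> (0 < i < j)%N ->
  (forall k, (1 < k < j)%N -> wbirths k <= A ^ k.-1 * c k) ->
  births N (fun n => gd n * psi n (hd n) * mom i n * mom (j - i) n / lam (hd n)) <=
  A ^ j.-1 * ((6 / 5) ^ minn i (j - i) * c i * c (j - i)%N).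
Proof.
move=> hj hi IH; have hk (i' k : nat) : (0 < i' <= Q)%N -> (1 < k < j)%N -> (i' + k)%N = j ->
  births N (fun n => gd n * psi n (hd n) * mom i' n * mom k n / lam (hd n)) <=
  A ^ j.-1 * ((6 / 5) ^ i' * c i' * c k).
  move=> hi' hk e; have t1 : 1 <= thr i' by apply: thr_ge1; lia.
  have t0 : 0 <= thr i' by lra.
  apply: Rle_trans (births_pair k hi') _.
  apply: Rle_trans (Rmult_le_compat_l _ _ _ t0 (IH k hk)) _.
  by rewrite -e; apply: thr_pow; lia.
case: (leqP i (j - i)) => ij; first by apply: hk; lia.
have -> : births N (fun n => gd n * psi n (hd n) * mom i n * mom (j - i) n / lam (hd n)) =
  births N (fun n => gd n * psi n (hd n) * mom (j - i) n * mom i n / lam (hd n)).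
  by apply: (births_ext q_ge0 q_le) => n _; lra.
rewrite (_ : _ * c (j - i)%N = (6 / 5) ^ (j - i) * c (j - i)%N * c i); last lra.
by apply: hk; lia.
Qed.

(** For [j = 2] the left side is at most [51 * 165 * B * A], whence the 10000 in [c_ge]. For [j > 2]
    the factor [B] of [src_le] cancels in [c_conv], and the same 10000 leaves room for the 51. *)
Lemma src_bound j : (1 < j <= Q)%N -> 51 * (sqrt A + src j) <= A ^ j.-1 * c j.
Proof.
elim/ltn_ind: j => j IH hj.
have hA : sqrt A * sqrt A = A by apply: sqrt_sqrt; lra.
have s1 : 1 <= sqrt A by rewrite -{1}sqrt_1; apply: sqrt_le_1_alt; lra.
have sA : sqrt A <= A by nra.
have cj := @c_ge j ltac:(lia).
have Aj : A <= A ^ j.-1.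
  by case: j hj {IH cj} => [|[|j]] //= _; have h := powA_ge1 j; rewrite -{1}[A]Rmult_1_r; apply: Rmult_le_compat_l; lra.
case: (ltnP 2 j) => j2; last first.
  have {IH} -> : j = 2%N by lia.
  have := src2_le; have := @c_ge 2 isT => c2 s2; rewrite /= Rmult_1_r.
  have : 0 <= A * (c 2%N - 10000 * B) by apply: Rmult_le_pos; lra.
  have : 0 <= A * (B - 1) by apply: Rmult_le_pos; lra.
  lra.
have hw k : (1 < k < j)%N -> wbirths k <= A ^ k.-1 * c k.
  move=> hk; have k0 : (0 < k)%N by lia.
  by apply: Rle_trans (wbirths_src k0) _; apply: IH; lia.
have : src j <= B * (A ^ j.-1 * (c j / (10000 * B))).
  apply: Rle_trans (src_le j) _; apply: Rmult_le_compat_l; first lra.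
  have hA0 : 0 <= A ^ j.-1 by lra.
  apply: Rle_trans _ (Rmult_le_compat_l _ _ _ hA0 (c_conv (j := j) ltac:(lia))).
  rewrite -sumR_mulr; apply: leR_sum => i; rewrite mem_index_iota => hi _.
  have h := @src_pair j i ltac:(lia) ltac:(lia) hw.
  have C0 : 0 <= INR 'C(j, i) * 2 ^ minn i (j - i).
    by apply: Rmult_le_pos; [exact: pos_INR|apply: pow_le; lra].
  have := Rmult_le_compat_l _ _ _ C0 h; rewrite (_ : 12 / 5 = 2 * (6 / 5)); last lra.
  rewrite Rpow_mult_distr; lra.
have -> : B * (A ^ j.-1 * (c j / (10000 * B))) = A ^ j.-1 * c j / 10000 by field; lra.
have : 0 <= (A ^ j.-1 - A) * (c j - 10000) by apply: Rmult_le_pos; lra.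
have : 0 <= (A ^ j.-1 - A) * 10000 by apply: Rmult_le_pos; lra.
have : 0 <= A * (c j - 10000) by apply: Rmult_le_pos; lra.
lra.
Qed.

Lemma source_total j : (0 < j <= Q)%N ->
  total N (fun p n => gd n * source j p n / lam p) <= A ^ j.-1 * c j.
Proof.
move=> hj.
have h1 : total N (fun p n => gd n * source j p n / lam p) <= src j.
  apply: (total_le q_ge0 q_le) => p n _ pn /=; have S0 := source_ge0 j p.+1 n.
  rewrite /gd; case: (boolP (good n)) => gn; last by rewrite /Rdiv !Rmult_0_l; lra.
  have h : tau n <= A * lam p.
    have l0 := lam_gt0 p; have := Rmult_le_compat_r _ _ _ (Rlt_le _ _ l0) (good_tau_path gn pn).
    by rewrite /Rdiv Rmult_assoc Rinv_l ?Rmult_1_r //; lra.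
  rewrite /Rdiv; apply: Rmult_le_compat_l; first lra.
  apply: Rle_trans (psi_lower h); rewrite /Rdiv Rmult_1_l.
  have l0 := lam_gt0 p; apply: Rinv_le_contravar => //.
  exact: (lam_le q_ge0 (leqnSn p)).
apply: Rle_trans h1 _.
have := powA_ge1 j.-1; have := @c_ge1 j.
case: (ltnP 1 j) => j1.
  have : 0 <= src j.
    apply: (total_ge0 q_ge0 q_le) => p n _ _; apply: Rmult_le_pos; last exact/Rlt_le/psi_pos.
    by apply: Rmult_le_pos; [exact: gd_ge0|exact: source_ge0].
  have := @src_bound j ltac:(lia); have := sqrt_pos A; lra.
have -> : j = 1%N by lia.
move=> _ _; rewrite /= c1.
apply: Rle_trans (src_le 1) _; rewrite big_geq //; lra.
Qed.

(** * Exits and the probability of stopping *)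

Lemma flux_mom j : (0 < j <= Q)%N ->
  total N (fun p n => (gd n - gd (p :: n)) * mom j (p :: n) / lam p) <= 2 * (A ^ j.-1 * c j).
Proof.
move=> hj; have j0 : (0 < j)%N by lia.
have h := flux (T := mom j) (S := source j) q_ge0 q_le N gd_ge0 _.
have {h} := h ltac:(by move=> p n; rewrite mom_source //; lra).
rewrite mom_nil // /gd /=.
have : 0 <= Ex N (fun n => gd n * mom j n) / lam N.
  apply: Rcomplements.Rdiv_le_0_compat => //; apply: (Ex_ge0 q_ge0 q_le) => n _.
  by apply: Rmult_le_pos; [exact: gd_ge0|exact: mom_ge0].
have := source_total hj; rewrite /gd.
have := powA_ge1 j.-1; have := @c_ge1 j j0 => hc hA.
have : 1 <= A ^ j.-1 * c j by nra.
lra.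
Qed.

Lemma bad_births : 1 - Ex N gd = total N (fun p n => gd n - gd (p :: n)).
Proof.
rewrite /total; elim: N => [|m IH]; first by rewrite big_nil /gd /=; lra.
rewrite big_nat_recr //= -IH.
have -> : Ex m (fun n => gd n - gd (m.+1 :: n)) = Ex m gd + -1 * Ex m (fun n => gd (m.+1 :: n)).
  by rewrite -ExZ -ExD; apply: (Ex_ext q_ge0 q_le) => n _; lra.
lra.
Qed.

(** Markov's inequality at an exit: some order [j] has [mom j (p :: n) > thr j * lam p], so its term
    alone exceeds 1. *)
Lemma exit_le p n : gd n - gd (p :: n) <=
  \sum_(1 <= j < Q.+1) (/ thr j * ((gd n - gd (p :: n)) * mom j (p :: n) / lam p)).
Proof.
have s0 : 0 <= \sum_(1 <= j < Q.+1) (/ thr j * ((gd n - gd (p :: n)) * mom j (p :: n) / lam p)).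
  apply: sumR_ge0 => j; rewrite mem_index_iota => hj _.
  have t1 : 1 <= thr j by apply: thr_ge1; lia.
  apply: Rmult_le_pos; first by apply: Rlt_le; apply: Rinv_0_lt_compat; lra.
  apply: Rcomplements.Rdiv_le_0_compat => //; apply: Rmult_le_pos; [exact: gd_le|exact: mom_ge0].
have H : gd n - gd (p :: n) = 0 \/ gd n - gd (p :: n) = 1 /\ ~~ okb (p :: n).
  rewrite /gd /=; case: (good n) => /=; last by left; lra.
  by case: (okb _) => /=; [left|right; split]; try lra.
case: H s0 => [-> //|[-> okn] _].
case/allPn: okn => j; rewrite mem_iota => hj /RlebP /Rnot_le_lt /= h.
have l0 := lam_gt0 p; have t1 : 1 <= thr j by apply: thr_ge1; lia.
apply: (@Rle_trans _ (/ thr j * (1 * mom j (p :: n) / lam p))).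
  apply: (Rmult_le_reg_r (thr j * lam p)); first by apply: Rmult_lt_0_compat; lra.
  have -> : / thr j * (1 * mom j (p :: n) / lam p) * (thr j * lam p) = mom j (p :: n) by field; lra.
  lra.
have jI : j \in index_iota 1 Q.+1 by rewrite mem_index_iota; lia.
apply: (leR_sum_term (F := fun j => / thr j * (1 * mom j (p :: n) / lam p)) jI) => i.
rewrite mem_index_iota => hi.
have ti : 1 <= thr i by apply: thr_ge1; lia.
apply: Rmult_le_pos; first by apply: Rlt_le; apply: Rinv_0_lt_compat; lra.
by apply: Rcomplements.Rdiv_le_0_compat => //; rewrite Rmult_1_l; exact: mom_ge0.
Qed.

Lemma geom_le x m : 0 <= x < 1 -> \sum_(0 <= j < m) x ^ j <= / (1 - x).
Proof.
move=> hx; suff -> : \sum_(0 <= j < m) x ^ j = (1 - x ^ m) / (1 - x).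
  apply: (@Rle_trans _ (1 / (1 - x))); last by rewrite /Rdiv Rmult_1_l; lra.
  apply: Rmult_le_compat_r; first by apply: Rlt_le; apply: Rinv_0_lt_compat; lra.
  have : 0 <= x ^ m by apply: pow_le; lra.
  lra.
elim: m => [|m IH]; first by rewrite big_nil /=; field; lra.
by rewrite big_nat_recr //= IH; field; lra.
Qed.

Lemma bad_prob : 1 - Ex N gd <= 12 / A.
Proof.
rewrite bad_births; apply: (@Rle_trans _ (total N (fun p n => \sum_(1 <= j < Q.+1)
  (/ thr j * ((gd n - gd (p :: n)) * mom j (p :: n) / lam p))))).
  by apply: (total_le q_ge0 q_le) => p n _ _; exact: exit_le.
rewrite (total_sum q_ge0 q_le).
(* Dividing by [thr j] cancels [c j] and all powers of [A] but one; the geometric series that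
   remains has sum at most 6. *)
apply: (@Rle_trans _ (\sum_(1 <= j < Q.+1) (2 / A * (5 / 6) ^ j.-1))).
  apply: leR_sum => j; rewrite mem_index_iota => hj _; rewrite totalZ.
  have j0 : (0 < j)%N by lia.
  have t1 := thr_ge1 j0; have := c_ge1 j0 => hc.
  apply: (Rmult_le_reg_l (thr j)); first lra.
  rewrite -Rmult_assoc Rinv_r ?Rmult_1_l; last lra.
  apply: Rle_trans (flux_mom hj) _; apply: Req_le; rewrite /thr.
  case: j j0 {hj t1 hc} => // j _ /=.
  have -> : 5 / 6 = / (6 / 5) by lra.
  rewrite pow_inv; field; split; first by apply: pow_nonzero; lra.
  lra.
rewrite sumR_mulr big_add1 /=.
have := @geom_le (5 / 6) Q ltac:(lra) => h.
have -> : 12 / A = 2 / A * 6 by lra.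
apply: Rmult_le_compat_l; first by apply: Rlt_le; apply: Rdiv_lt_0_compat; lra.
lra.
Qed.

Lemma good_cnt n w : good n -> path gtn N.+1 n ->
  INR (cnt l G n w) ^ Q <= (12 / 5 * A) ^ Q * c Q * lam N.
Proof.
move=> gn pn; apply: Rle_trans (@cnt_le_mom l G G_gt0 Q n w Q_gt0) _.
have h := good_mom gn (j := Q) ltac:(lia).
have p0 : 0 <= 2 ^ Q by apply: pow_le; lra.
apply: Rle_trans (Rmult_le_compat_l _ _ _ p0 h) _.
have cQ := c_ge1 Q_gt0; have A1 := powA_ge1 Q.
have l0 := lam_gt0 (hd n).
have l1 : lam (hd n) <= lam N.
  by apply: lam_le => //; case: n pn {gn h l0} => //= p n /andP[].
rewrite (_ : 12 / 5 * A = 2 * A * (6 / 5)); last lra.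
rewrite 2!Rpow_mult_distr /thr.
have r1 : (6 / 5) ^ Q.-1 <= (6 / 5) ^ Q by apply: Rle_pow; [lra|apply/leP; lia].
have r0 : 0 < (6 / 5) ^ Q.-1 by apply: pow_lt; lra.
have -> : 2 ^ Q * (A ^ Q * c Q * (6 / 5) ^ Q.-1 * lam (hd n)) =
  (2 ^ Q * A ^ Q * c Q) * ((6 / 5) ^ Q.-1 * lam (hd n)) by lra.
have -> : 2 ^ Q * A ^ Q * (6 / 5) ^ Q * c Q * lam N =
  (2 ^ Q * A ^ Q * c Q) * ((6 / 5) ^ Q * lam N) by lra.
apply: Rmult_le_compat_l; first by do !apply: Rmult_le_pos; lra.
by apply: Rmult_le_compat; lra.
Qed.

End Main.

(** * The mean of the maximal window count *)

(** With fourth roots, the exponent [7 / 4] becomes the natural power 7. *)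
Definition root4 (x : R) : R := sqrt (sqrt x).

Lemma root4_ge0 x : 0 <= root4 x. Proof. exact: sqrt_pos. Qed.

Lemma root4_pow x : 0 <= x -> root4 x ^ 4 = x.
Proof.
move=> x0; have e1 := sqrt_sqrt _ (sqrt_pos x); have e2 := sqrt_sqrt _ x0.
rewrite (_ : root4 x ^ 4 = (root4 x * root4 x) * (root4 x * root4 x)); last by ring.
by rewrite /root4 e1 e2.
Qed.

Lemma root4M x y : 0 <= x -> 0 <= y -> root4 (x * y) = root4 x * root4 y.
Proof. by move=> x0 y0; rewrite /root4 sqrt_mult // sqrt_mult //; exact: sqrt_pos. Qed.

Lemma root4_le x y : x <= y -> root4 x <= root4 y.
Proof. by move=> xy; do 2!apply: sqrt_le_1_alt. Qed.

Lemma root4_1 : root4 1 = 1. Proof. by rewrite /root4 !sqrt_1. Qed.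

Lemma root4_ge1 x : 1 <= x -> 1 <= root4 x.
Proof. by move=> /root4_le; rewrite root4_1. Qed.

Lemma root4X x m : 0 <= x -> root4 (x ^ m) = root4 x ^ m.
Proof.
move=> x0; elim: m => [|m IH] /=; first exact: root4_1.
by rewrite root4M // ?IH //; exact: pow_le.
Qed.

Lemma central_bin_rec m : (m.+1 * 'C(m.+1.*2, m.+1) = 2 * m.*2.+1 * 'C(m.*2, m))%N.
Proof.
have h1 := @bin_fact (m.+1.*2) m.+1 ltac:(lia).
have h2 := @bin_fact (m.*2) m ltac:(lia).
rewrite (_ : (m.+1.*2 - m.+1)%N = m.+1) in h1; last lia.
rewrite (_ : (m.*2 - m)%N = m) in h2; last lia.
rewrite doubleS !factS -h2 in h1.
have f0 : (0 < m`! * m`! * m.+1)%N by rewrite !muln_gt0 fact_gt0.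
apply/eqP; rewrite -(eqn_pmul2r f0) doubleS; apply/eqP.
move: h1; move: ('C(_, _)) ('C(_, _)) (m`!) => a b f; nia.
Qed.

(** The ratio of consecutive central binomial coefficients is [2 * (2 * k + 1) / (k + 1)], at least
    3.5 from [k = 3] on. *)
Lemma central_bin_ge m : 0.39 * 3.5 ^ m <= INR 'C(m.*2, m).
Proof.
have H k : (3 <= k)%N -> 0.39 * 3.5 ^ k <= INR 'C(k.*2, k).
  elim: k => // k IH; rewrite leq_eqVlt => /orP[/eqP <-|k3].
    by rewrite (_ : 'C(3.*2, 3) = 20%N) // /=; lra.
  have := central_bin_rec k => /(f_equal INR); rewrite !INR_muln.
  have := IH k3; set a := INR 'C(k.*2, k); set b := INR 'C(_, _) => ha.
  have -> : INR k.*2.+1 = 2 * INR k + 1 by rewrite S_INR -muln2 INR_muln /=; lra.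
  rewrite S_INR (_ : INR 2 = 2) // => e.
  have k4 : 3 <= INR k by have := INR_leq (k3 : (3 <= k)%N); rewrite /=; lra.
  have a0 : 0 <= a by exact: pos_INR.
  have : (INR k + 1) * (3.5 * a) <= (INR k + 1) * b by nra.
  move=> /Rmult_le_reg_l => /(_ ltac:(lra)); rewrite /=; lra.
case: m => [|[|[|m]]]; try by apply: H.
- by rewrite /=; lra.
- by rewrite (_ : 'C(1.*2, 1) = 2%N) // /=; lra.
- by rewrite (_ : 'C(2.*2, 2) = 6%N) // /=; lra.
Qed.

Lemma bin_ge j i : (i <= j)%N -> 0.39 * 3.5 ^ minn i (j - i) <= INR 'C(j, i).
Proof.
move=> ij; apply: Rle_trans (central_bin_ge _) _; apply: INR_leq.
case: (leqP i (j - i)) => h; first by apply: leq_bin2l; lia.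
by rewrite -[X in (_ <= X)%N]bin_sub //; apply: leq_bin2l; lia.
Qed.

Lemma root4_bin_ge j i : (i <= j)%N -> 0.79 * 1.36 ^ minn i (j - i) <= root4 (INR 'C(j, i)).
Proof.
move=> ij; have := bin_ge ij; set m := minn _ _ => h.
have p0 : 0 < 1.36 ^ m by apply: pow_lt; lra.
have r0 : 0 <= 0.79 * 1.36 ^ m by lra.
rewrite -(root4_pow r0) -root4X //.
apply: root4_le; apply: Rle_trans h.
rewrite Rpow_mult_distr -pow_mult [(_ * 4)%coq_nat]Nat.mul_comm pow_mult.
apply: Rmult_le_compat; [by apply: pow_le; lra|by apply: pow_le; apply: pow_le; lra|rewrite /=; lra|].
by apply: pow_incr; rewrite /=; lra.
Qed.

(* The exponent [7 / 4] is what makes [coef_conv] hold: each term of the convolution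
   gains [C(j, i) ^ (- 3 / 4) <= 2.1 * (1.36 ^ 3) ^ (- minn i (j - i))], which beats
   the factor [(12 / 5) ^ minn i (j - i)]. *)
Definition coef (D : R) (j : nat) : R := D ^ j.-1 * root4 (INR j`!) ^ 7.

Lemma fact_ge1 j : 1 <= INR j`!.
Proof. by have := INR_leq (fact_gt0 j); rewrite /=; lra. Qed.

Lemma coef_ge D j : 1 <= D -> (1 < j)%N -> D <= coef D j.
Proof.
case: j => [|[|j]] // D1 _; rewrite /coef [j.+2.-1]/=.
have h1 : 1 <= D ^ j by apply: pow_R1_Rle.
have h2 : 1 <= root4 (INR j.+2`!) ^ 7 by apply: pow_R1_Rle; apply: root4_ge1; exact: fact_ge1.
have h3 : 1 <= D ^ j * root4 (INR j.+2`!) ^ 7 by nra.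
rewrite -tech_pow_Rmult; nra.
Qed.

Lemma coef_term D j i : 1 <= D -> (0 < i < j)%N ->
  INR 'C(j, i) * (12 / 5) ^ minn i (j - i) * coef D i * coef D (j - i) <=
  coef D j / D * (2.1 * (24 / 25) ^ minn i (j - i)).
Proof.
move=> D1 hij; have ij : (i <= j)%N by lia.
have := root4_bin_ge ij; set m := minn _ _; set b := root4 _ => hb.
have fE : INR j`! = INR 'C(j, i) * INR i`! * INR (j - i)`!.
  by rewrite -(bin_fact ij) !INR_muln; lra.
have bE : INR 'C(j, i) = b ^ 4 by rewrite root4_pow //; exact: pos_INR.
rewrite /coef bE fE !root4M //; try by [exact: pos_INR|apply: Rmult_le_pos; exact: pos_INR].
rewrite -/b; move: (root4_ge0 (INR i`!)) (root4_ge0 (INR (j - i)`!)).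
move: (root4 (INR i`!)) (root4 (INR (j - i)`!)) => x y x0 y0.
have -> : D ^ j.-1 * (b * x * y) ^ 7 / D * (2.1 * (24 / 25) ^ m) =
   (D ^ i.-1 * D ^ (j - i).-1 * x ^ 7 * y ^ 7 * b ^ 4) * (b ^ 3 * (2.1 * (24 / 25) ^ m)).
  rewrite -pow_add (_ : j.-1 = (i.-1 + (j - i).-1)%coq_nat.+1); last by lia.
  rewrite -tech_pow_Rmult; field; lra.
have -> : b ^ 4 * (12 / 5) ^ m * (D ^ i.-1 * x ^ 7) * (D ^ (j - i).-1 * y ^ 7) =
  (D ^ i.-1 * D ^ (j - i).-1 * x ^ 7 * y ^ 7 * b ^ 4) * (12 / 5) ^ m by ring.
have b0 : 0 <= b by exact: root4_ge0.
apply: Rmult_le_compat_l; first by do !apply: Rmult_le_pos; try apply: pow_le; lra.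
have p0 : 0 < 1.36 ^ m by apply: pow_lt; lra.
have h3 : (0.79 * 1.36 ^ m) ^ 3 <= b ^ 3 by apply: pow_incr; lra.
have r0 : 0 <= (24 / 25) ^ m by apply: pow_le; lra.
apply: (@Rle_trans _ ((0.79 * 1.36 ^ m) ^ 3 * (2.1 * (24 / 25) ^ m))); last first.
  by apply: Rmult_le_compat_r; lra.
(* Here [1.36 ^ 3 * (24 / 25)] is 2.414..., just above [12 / 5]; the other constants satisfy
   [0.79 ^ 3 * 2.1 > 1]. *)
apply: (@Rle_trans _ ((1.36 ^ 3 * (24 / 25)) ^ m)).
  by apply: pow_incr; rewrite /=; lra.
rewrite Rpow_mult_distr -pow_mult [(3 * m)%coq_nat]Nat.mul_comm pow_mult.
have : 0 <= (1.36 ^ m) ^ 3 * (24 / 25) ^ m by apply: Rmult_le_pos => //; apply: pow_le; lra.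
by rewrite /=; lra.
Qed.

Lemma coef_conv D j : 1 <= D -> (1 < j)%N ->
  \sum_(1 <= i < j) (INR 'C(j, i) * (12 / 5) ^ minn i (j - i) * coef D i * coef D (j - i))
  <= 105 * coef D j / D.
Proof.
move=> D1 j1.
have c0 : 0 <= coef D j / D * 2.1 by have := coef_ge D1 j1 => h; apply: Rmult_le_pos; [apply: Rcomplements.Rdiv_le_0_compat|]; lra.
apply: (@Rle_trans _ (\sum_(1 <= i < j) (coef D j / D * 2.1 * (24 / 25) ^ minn i (j - i)))).
  apply: leR_sum => i; rewrite mem_index_iota => hi _.
  have := coef_term D1 hi; lra.
rewrite sumR_mulr (_ : 105 * coef D j / D = coef D j / D * 2.1 * 50); last lra.
apply: Rmult_le_compat_l => //.
have g m : \sum_(0 <= i < m) (24 / 25) ^ i <= 25 by have := @geom_le (24 / 25) m ltac:(lra); lra.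
have z i : 0 <= (24 / 25) ^ i by apply: pow_le; lra.
(* The minimum is one of the two exponents, and each geometric series is at most 25: hence
   [105 = 2.1 * 50]. *)
apply: (@Rle_trans _ (\sum_(1 <= i < j) ((24 / 25) ^ i + (24 / 25) ^ (j - i)))).
  apply: leR_sum => i; rewrite mem_index_iota => hi _; have := z i; have := z (j - i)%N.
  by rewrite /minn; case: ifP; lra.
rewrite big_split /= [X in _ + X](_ : _ = \sum_(1 <= i < j) (24 / 25) ^ i); last first.
  rewrite big_nat_rev; apply: eq_big_nat => i hi; congr (_ ^ _); lia.
by have := g j; rewrite big_ltn; [have := z 0%N; lra|lia].
Qed.

Definition cmax (l : nat -> nat) (G : nat) (n : seq nat) : nat :=
  \max_(0 <= w < range l G n) cnt l G n w.

Lemma cmax_sup l G n w : (0 < G)%N -> (cnt l G n w <= cmax l G n)%N.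
Proof.
move=> G0; case: (ltnP w (range l G n)) => h; last by rewrite cnt_range.
by apply: (leq_bigmax_seq (F := cnt l G n)) => //; rewrite mem_index_iota.
Qed.

Lemma cmax_le l G n b : (forall w, (cnt l G n w <= b)%N) -> (cmax l G n <= b)%N.
Proof. by move=> h; apply/bigmax_leqP_seq => w _ _. Qed.

Lemma root4_fact_le m : root4 (INR m`!) <= root4 (INR m) ^ m.
Proof.
rewrite -root4X; last exact: pos_INR.
apply: root4_le; rewrite -INR_expn; apply: INR_leq; elim: m => // m IH.
rewrite factS expnS leq_mul2l; apply/orP; right.
by apply: leq_trans IH _; case: m => // m; rewrite leq_exp2r.
Qed.

Lemma pow_lt_compat x y m : (0 < m)%N -> 0 <= x < y -> x ^ m < y ^ m.
Proof.
case: m => // m _ hxy; elim: m => [|m IH] /=; first by rewrite !Rmult_1_r; lra.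
have h : 0 <= x ^ m.+1 by apply: pow_le; lra.
apply: (@Rle_lt_trans _ (y * x ^ m.+1)); first by apply: Rmult_le_compat_r; rewrite //=; lra.
by apply: Rmult_lt_compat_l; [lra|exact: IH].
Qed.

(** For [x > D], the term of the largest [k < m] with [x > D * 2 ^ k] is [2 * D * 2 ^ k] and already
    dominates [x]. *)
Lemma dyadic_bound D x m : 0 <= D -> x <= D * 2 ^ m ->
  x <= D + \sum_(0 <= k < m) (2 * D * (2 ^ k * (if Rleb x (D * 2 ^ k) then 0 else 1))).
Proof.
move=> D0; elim: m => [|m IH]; first by rewrite big_nil /=; lra.
rewrite big_nat_recr //= => h.
have s0 : 0 <= \sum_(0 <= k < m) (2 * D * (2 ^ k * (if Rleb x (D * 2 ^ k) then 0 else 1))).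
  apply: sumR_ge0 => k _ _; have p0 : 0 < 2 ^ k by apply: pow_lt; lra.
  by case: Rleb; do !apply: Rmult_le_pos; lra.
case: RlebP => hx; first by have := IH hx; lra.
by lra.
Qed.

Section Mean.
Variables (q : nat -> R) (l : nat -> nat) (G : nat) (B : R) (N Q : nat).
Hypothesis q_ge0 : forall p, 0 <= q p.
Hypothesis q_le : forall p, q p <= 1 / 3.
Hypothesis G_gt0 : (0 < G)%N.
Hypothesis B_ge1 : 1 <= B.
Hypothesis q_window : forall m M v w,
  \sum_(m <= p < M | near G (v + l p.+1) w) q p.+1 <= B / lam q m.
Hypothesis Q_gt0 : (0 < Q)%N.
Hypothesis lam_Q : lam q N <= 3 ^ Q.

(** Chosen so that the bound of [coef_conv] has [105 / D = 1 / (10000 * B)]. In [D0], the factor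
    [36 / 5] is the [12 / 5] of [good_cnt] times the 3 of [lam_Q], and the power of [root4 (INR Q)]
    comes from bounding the factorial of [Q] by [Q ^ Q]. *)
Let D := 1050000 * B.
Let D0 := 36 / 5 * D * root4 (INR Q) ^ 7.

Lemma D_ge1 : 1 <= D. Proof. rewrite /D; lra. Qed.

Lemma root4Q_ge1 : 1 <= root4 (INR Q).
Proof. by apply: root4_ge1; have := INR_leq Q_gt0; rewrite /=; lra. Qed.

Lemma D0_ge1 : 1 <= D0.
Proof.
have := D_ge1; have : 1 <= root4 (INR Q) ^ 7 by apply: pow_R1_Rle; exact: root4Q_ge1.
move=> h1 h2; have h3 : 1 <= D * root4 (INR Q) ^ 7 by nra.
by rewrite /D0; lra.
Qed.

Lemma cmax_tail A : 1 <= A ->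
  Ex q N (fun n => if Rleb (INR (cmax l G n)) (D0 * A) then 0 else 1) <= 12 / A.
Proof.
move=> A1; have D1 := D_ge1.
have c1 : coef D 1 = 1 by rewrite /coef /= root4_1; lra.
have cg j : (1 < j)%N -> 10000 * B <= coef D j.
  by move=> j1; apply: Rle_trans (coef_ge D1 j1); rewrite /D; lra.
have cc j : (1 < j)%N ->
  \sum_(1 <= i < j) (INR 'C(j, i) * (12 / 5) ^ minn i (j - i) * coef D i * coef D (j - i)%N)
  <= coef D j / (10000 * B).
  move=> j1; apply: Rle_trans (coef_conv D1 j1) _; apply: Req_le; rewrite /D; field; lra.
apply: Rle_trans (bad_prob q_ge0 q_le G_gt0 B_ge1 q_window N c1 cg cc A1 Q_gt0).
set g := gd _ _ _ _ _ _.
have -> : 1 - Ex q N g = Ex q N (fun n => 1 + -1 * g n).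
  by rewrite ExD ExZ Ex_const; lra.
apply: (Ex_le q_ge0 q_le) => n pn; rewrite /g /gd.
case: (boolP (good _ _ _ _ _ _ n)) => gn; last by case: Rleb; lra.
case: RlebP => [_|[]]; first lra.
have y0 : 0 <= D0 * A by have := D0_ge1; nra.
suff hw w : INR (cnt l G n w) <= D0 * A.
  rewrite /cmax; apply: (big_ind (fun m : nat => INR m <= D0 * A)) => //.
  by move=> a b ha hb; rewrite /maxn; case: ifP.
apply: Rnot_lt_le => hlt.
have := good_cnt q_ge0 G_gt0 B_ge1 c1 cg A1 Q_gt0 w gn pn.
apply: Rlt_not_le.
apply: Rle_lt_trans (pow_lt_compat Q_gt0 (conj y0 hlt)).
have k0 : 0 <= (12 / 5 * A) ^ Q by apply: pow_le; lra.
rewrite Rmult_assoc (_ : D0 * A = 12 / 5 * A * (D * root4 (INR Q) ^ 7 * 3)); last by rewrite /D0; lra.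
rewrite (Rpow_mult_distr (12 / 5 * A)); apply: Rmult_le_compat_l => //.
rewrite (Rpow_mult_distr (D * _)) (Rpow_mult_distr D); have l0 := lam_gt0 q_ge0 N.
have r0 := root4_ge0 (INR Q); have f0 := root4_ge0 (INR Q`!).
apply: Rmult_le_compat => //; try lra.
  by apply: Rmult_le_pos; apply: pow_le => //; lra.
apply: Rmult_le_compat; try by apply: pow_le => //; lra.
  by apply: Rle_pow => //; apply/leP; exact: leq_pred.
rewrite -pow_mult Nat.mul_comm pow_mult; apply: pow_incr; split=> //.
exact: root4_fact_le.
Qed.

(** The mean is the product of the factors [1 + 3 * q], each at most [(1 + q) ^ 3]. *)
Lemma Ex_size2 m : Ex q m (fun n => (2 ^ size n) ^ 2) <= lam q m ^ 3.
Proof.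
elim: m => [|m IH] /=; first lra.
have q0 := q_ge0 m.+1; have q1 := q_le m.+1; have l1 := lam_ge1 q_ge0 m.
have -> : Ex q m (fun n => 2 * 2 ^ size n * (2 * 2 ^ size n * 1)) = 4 * Ex q m (fun n => (2 ^ size n) ^ 2).
  by rewrite -ExZ; apply: (Ex_ext q_ge0 q_le) => n _ /=; lra.
have -> : Ex q m (fun n => 2 ^ size n * (2 ^ size n * 1)) = Ex q m (fun n => (2 ^ size n) ^ 2) by [].
set x := Ex q m _ in IH *; set L := lam q m in IH l1 *.
have L3 : 0 <= L ^ 3 by apply: pow_le; lra.
apply: (@Rle_trans _ ((1 + 3 * q m.+1) * L ^ 3)); first nra.
have -> : L * (1 + q m.+1) * (L * (1 + q m.+1) * (L * (1 + q m.+1) * 1)) = (1 + q m.+1) ^ 3 * L ^ 3 by ring.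
apply: Rmult_le_compat_r => //; rewrite /=; nra.
Qed.

Theorem mean_cmax :
  Ex q N (fun n => INR (cmax l G n)) <= 1000000000 * B * (INR Q * root4 (INR Q) ^ 7).
Proof.
have D01 := D0_ge1.
(* A count above [D0 * 2 ^ K] is at most [tau ^ 2 / 2 ^ K], and the mean of this is at most
   [27 ^ Q / 32 ^ Q]: this is why 5 is taken. *)
pose K := (5 * Q)%N.
have p0 k : 0 < 2 ^ k by apply: pow_lt; lra.
have key n : INR (cmax l G n) <= D0 +
    \sum_(0 <= k < K) (2 * D0 * (2 ^ k * (if Rleb (INR (cmax l G n)) (D0 * 2 ^ k) then 0 else 1)))
    + / 2 ^ K * (2 ^ size n) ^ 2.
  have i0 : 0 < / 2 ^ K by apply: Rinv_0_lt_compat.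
  have t2 : 0 <= (2 ^ size n) ^ 2 by apply: pow_le; exact: Rlt_le.
  case: (Rle_dec (INR (cmax l G n)) (D0 * 2 ^ K)) => [h|/Rnot_le_lt h].
    have := dyadic_bound (Rle_trans _ _ _ Rle_0_1 D01) h.
    by have := Rmult_le_pos _ _ (Rlt_le _ _ i0) t2; lra.
  have s0 : 0 <= \sum_(0 <= k < K) (2 * D0 * (2 ^ k * (if Rleb (INR (cmax l G n)) (D0 * 2 ^ k) then 0 else 1))).
    apply: sumR_ge0 => k _ _; have := p0 k.
    case: Rleb => pk; apply: Rmult_le_pos; [lra|apply: Rmult_le_pos; lra|lra|apply: Rmult_le_pos; lra].
  suff : INR (cmax l G n) <= / 2 ^ K * (2 ^ size n) ^ 2 by lra.
  have hc : INR (cmax l G n) <= 2 ^ size n.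
    have := INR_leq (cmax_le (fun w => cnt_le_size l G n w)).
    by rewrite INR_expn.
  have hK : 2 ^ K <= INR (cmax l G n) by have := p0 K; nra.
  apply: (Rmult_le_reg_l (2 ^ K)) => //; rewrite -Rmult_assoc Rinv_r ?Rmult_1_l; last by have := p0 K; lra.
  rewrite /= Rmult_1_r; apply: Rmult_le_compat => //; try lra.
    exact: Rlt_le.
  exact: pos_INR.
apply: Rle_trans (Ex_le q_ge0 q_le (fun n _ => key n)) _.
rewrite !ExD Ex_const (Ex_sum q_ge0 q_le) ExZ.
have hs : \sum_(0 <= k < K) Ex q N (fun n => 2 * D0 * (2 ^ k *
     (if Rleb (INR (cmax l G n)) (D0 * 2 ^ k) then 0 else 1))) <= \sum_(0 <= k < K) (24 * D0).
  apply: leR_sum => k _ _; rewrite ExZ ExZ.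
  have k1 : 1 <= 2 ^ k by apply: pow_R1_Rle; lra.
  have h := cmax_tail k1.
  have -> : 24 * D0 = 2 * D0 * (2 ^ k * (12 / 2 ^ k)) by field; lra.
  by apply: Rmult_le_compat_l; [lra|apply: Rmult_le_compat_l; lra].
rewrite sumR_const size_iota subn0 /K INR_muln in hs.
have h2 : / 2 ^ K * Ex q N (fun n => (2 ^ size n) ^ 2) <= 1.
  apply: (Rmult_le_reg_l (2 ^ K)) => //; rewrite -Rmult_assoc Rinv_r ?Rmult_1_l; last by have := p0 K; lra.
  apply: Rle_trans (Ex_size2 N) _; rewrite Rmult_1_r.
  have l1 := lam_ge1 q_ge0 N.
  apply: (@Rle_trans _ ((3 ^ Q) ^ 3)); first by apply: pow_incr; lra.
  rewrite -pow_mult Nat.mul_comm pow_mult /K (_ : (5 * Q)%N = (5 * Q)%coq_nat) // pow_mult.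
  by apply: pow_incr; rewrite /=; lra.
have Q1 : 1 <= INR Q by have := INR_leq Q_gt0; rewrite /=; lra.
have e5 : INR 5 = 5 by rewrite /=; lra.
rewrite e5 in hs.
apply: (@Rle_trans _ (D0 + 5 * INR Q * (24 * D0) + 1)).
  by apply: Rplus_le_compat => //; apply: Rplus_le_compat_l.
apply: (@Rle_trans _ (122 * (INR Q * D0))); first nra.
rewrite /D0 /D.
have r0 : 0 <= INR Q * root4 (INR Q) ^ 7 by apply: Rmult_le_pos; [lra|apply: pow_le; exact: root4_ge0].
have := Rmult_le_pos _ _ (ltac:(lra) : 0 <= B) r0; lra.
Qed.

End Mean.

(** * Chebyshev and Mertens bounds *)

Section Chebyshev.
Local Open Scope nat_scope.

Lemma prod_primes_dvd (r : seq nat) m : uniq r ->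
  (forall p, p \in r -> prime p -> p %| m) -> \prod_(p <- r | prime p) p %| m.
Proof.
elim: r => [|p r IH] /=; first by rewrite big_nil dvd1n.
move=> /andP[pr ur] H; rewrite big_cons.
have {}IH : \prod_(i <- r | prime i) i %| m by apply: IH => // i ir; apply: H; rewrite inE ir orbT.
case: ifP => // pp; rewrite Gauss_dvd; first by rewrite IH H // mem_head.
rewrite big_seq_cond; apply: (big_ind (coprime p)) => [|x y|i /andP[ir ip]].
- by rewrite coprimen1.
- by rewrite coprimeMr => -> ->.
- by rewrite prime_coprime // dvdn_prime2 //; apply: contraNneq pr => ->.
Qed.

Lemma prime_dvd_fact p n : prime p -> p %| n`! -> p <= n.
Proof.
move=> pp; elim: n => [|n IH]; first by rewrite fact0 dvdn1 => /eqP p1; rewrite p1 in pp.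
rewrite factS Euclid_dvdM // => /orP[/dvdn_leq|/IH]; [exact|lia].
Qed.

Lemma bin_middle_le m : 'C(m.*2.+1, m) <= 4 ^ m.
Proof.
have h : 'C(m.*2.+1, m) = 'C(m.*2.+1, m.+1) by rewrite -bin_sub; [congr binomial|]; lia.
have := expnDn 1 1 (m.*2.+1); rewrite (_ : 1 + 1 = 2) // expnS.
rewrite (_ : 4 ^ m = 2 ^ m.*2); last by rewrite -mul2n expnM.
rewrite -(big_mkord xpredT (fun i => 'C(m.*2.+1, i) * (1 ^ (m.*2.+1 - i) * 1 ^ i))).
under eq_bigr do rewrite !exp1n !muln1.
rewrite (@big_cat_nat _ _ _ m) /=; [|lia|lia].
rewrite (@big_ltn _ _ _ m); last lia.
rewrite (@big_ltn _ _ _ m.+1); last lia.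
rewrite -h; lia.
Qed.

(** The argument of Erdős: the primes in [(m + 1, 2 * m + 1]] all divide a binomial coefficient that
    is at most [4 ^ m], and an even number above 2 adds no prime. *)
Lemma primorial_le n : \prod_(0 <= p < n.+1 | prime p) p <= 4 ^ n.
Proof.
elim/ltn_ind: n => n IH.
case: n IH => [|[|[|n]]] IH; try by rewrite unlock.
case: (boolP (odd n)) => on.
  rewrite big_mkcond big_nat_recr //= -big_mkcond /=.
  have -> : prime n.+3 = false.
    by apply/negP => /even_prime[|] //; rewrite /= on.
  rewrite muln1; apply: leq_trans (IH n.+2 _) _ => //.
  by rewrite leq_exp2l.
have [m mE] : exists m, n.+3 = m.+1.*2.+1 by exists n./2; have := odd_double_half n; rewrite (negbTE on); lia.
rewrite mE (@big_cat_nat _ _ _ m.+3) //=; last lia.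
apply: (@leq_trans (4 ^ m.+2 * 4 ^ m.+1)); last by rewrite -expnD leq_exp2l //; lia.
apply: leq_mul; first by apply: IH; lia.
apply: leq_trans (bin_middle_le _); apply: dvdn_leq; first by rewrite bin_gt0; lia.
apply: prod_primes_dvd; first exact: iota_uniq.
move=> p; rewrite mem_index_iota => hp pp.
have pf : p %| (m.+1.*2.+1)`! by apply: dvdn_fact; lia.
move: pf; rewrite -(@bin_fact m.+1.*2.+1 m.+1); last lia.
rewrite Euclid_dvdM // => /orP[//|]; rewrite Euclid_dvdM // => /orP[] /(prime_dvd_fact pp); lia.
Qed.

End Chebyshev.

Definition theta (n : nat) : R := \sum_(0 <= p < n.+1 | prime p) ln (INR p).

Lemma INR_gt0 n : (0 < n)%N -> 0 < INR n.
Proof. by move=> n0; apply: lt_0_INR; apply/ltP. Qed.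

Lemma INR_ge1 n : (0 < n)%N -> 1 <= INR n.
Proof. by move=> n0; have := INR_leq n0; rewrite /=; lra. Qed.

Lemma ln_ge0 x : 1 <= x -> 0 <= ln x.
Proof. by move=> x1; rewrite -ln_1; apply: ln_le; lra. Qed.

Lemma ln_INR_prod (r : seq nat) (P : pred nat) : (forall p, p \in r -> P p -> (0 < p)%N) ->
  ln (INR (\prod_(p <- r | P p) p)) = \sum_(p <- r | P p) ln (INR p).
Proof.
move=> H; have : (0 < \prod_(p <- r | P p) p)%N /\
  ln (INR (\prod_(p <- r | P p) p)) = \sum_(p <- r | P p) ln (INR p); last by case.
rewrite big_seq_cond [X in _ = X]big_seq_cond.
elim/big_rec2: _ => [|p x y /andP[pr Pp] [x0 e]]; first by split; rewrite //= ln_1.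
have p0 := H p pr Pp; split; first by rewrite muln_gt0 p0.
by rewrite INR_muln ln_mult ?e //; exact: INR_gt0.
Qed.

Lemma ln2_bounds : 1 / 2 < ln 2 < 1.
Proof.
split; first by have := ln_lt_2; lra.
rewrite -[X in _ < X]ln_exp; apply: ln_increasing; first lra.
by have := exp_ineq1 1; lra.
Qed.

Lemma ln4_le : ln 4 <= 2.
Proof.
have -> : 4 = 2 * 2 by lra.
by rewrite ln_mult; try lra; have := ln2_bounds; lra.
Qed.

Lemma theta_le n : theta n <= 2 * INR n.
Proof.
rewrite /theta -ln_INR_prod; last by move=> p _ /prime_gt0.
have h := INR_leq (primorial_le n); rewrite INR_expn (_ : INR 4 = 4) in h; last by rewrite /=; lra.
have h0 : 0 < INR (\prod_(0 <= p < n.+1 | prime p) p).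
  by apply: INR_gt0; apply: prodn_cond_gt0 => p /prime_gt0.
apply: Rle_trans (ln_le _ _ h0 h) _; rewrite ln_pow; last lra.
by have := ln4_le; have := pos_INR n; nra.
Qed.

Lemma sum_primes1 (F : nat -> R) : \sum_(0 <= p < 1 | prime p) F p = 0.
Proof. by rewrite big_mkcond big_nat1. Qed.

Lemma ln_primes_dvd n : \sum_(0 <= p < n.+2 | prime p && (p %| n.+1)) ln (INR p) <= ln (INR n.+1).
Proof.
rewrite -ln_INR_prod; last by move=> p _ /andP[/prime_gt0].
apply: ln_le; first by apply: INR_gt0; apply: prodn_cond_gt0 => p /andP[/prime_gt0].
apply: INR_leq; apply: dvdn_leq => //.
rewrite -big_filter_cond big_filter_cond; under eq_bigl do rewrite andbC.
rewrite -big_filter_cond; apply: prod_primes_dvd; first by rewrite filter_uniq ?iota_uniq.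
by move=> p; rewrite mem_filter => /andP[].
Qed.

(** Legendre's formula without the higher prime powers; [n %/ p] increases at [n.+1] exactly when
    [p] divides [n.+1]. *)
Lemma ln_fact_ge n :
  \sum_(0 <= p < n.+1 | prime p) (ln (INR p) * INR (n %/ p)) <= ln (INR n`!).
Proof.
elim: n => [|n IH]; first by rewrite sum_primes1 /= ln_1; lra.
rewrite factS INR_muln ln_mult; try by apply: INR_gt0; rewrite // fact_gt0.
apply: Rle_trans (Rplus_le_compat _ _ _ _ (ln_primes_dvd n) IH).
have -> : \sum_(0 <= p < n.+1 | prime p) (ln (INR p) * INR (n %/ p)) =
   \sum_(0 <= p < n.+2 | prime p) (ln (INR p) * INR (n %/ p)).
  rewrite [RHS]big_mkcond [RHS]big_nat_recr //= -big_mkcond divn_small //=.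
  by case: (prime _); lra.
rewrite [X in X <= _]sumR_cond [X in _ <= X + _]sumR_cond [X in _ <= _ + X]sumR_cond -big_split.
apply: leR_sum => p _ _ /=; case: (boolP (prime p)) => pp /=; last by lra.
rewrite divnS ?prime_gt0 // INR_addn; case: (p %| _) => /=; lra.
Qed.

Definition psum (n : nat) : R := \sum_(0 <= p < n.+1 | prime p) (ln (INR p) / INR p).
Definition isum (n : nat) : R := \sum_(0 <= p < n.+1 | prime p) (/ INR p).

(** The upper half of Mertens' first theorem: [ln_fact_ge] is compared with [n ln n], and restoring
    the fractional parts costs [theta n <= 2 n]. *)
Lemma psum_le n : (0 < n)%N -> psum n <= ln (INR n) + 2.
Proof.
move=> n0; have N0 := INR_gt0 n0.
have hf : ln (INR n`!) <= INR n * ln (INR n).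
  elim: n {n0 N0} => [|n IH]; first by rewrite /= ln_1; lra.
  have n1 := @INR_ge1 n.+1 isT.
  rewrite factS INR_muln ln_mult; try by apply: INR_gt0; rewrite // fact_gt0.
  have e : INR n.+1 * ln (INR n.+1) = (INR n + 1) * ln (INR n.+1) by rewrite {1}S_INR.
  suff : INR n * ln (INR n) <= INR n * ln (INR n.+1) by rewrite e; lra.
  case: n {IH n1 e} => [|n]; first by rewrite /=; lra.
  apply: Rmult_le_compat_l; first exact: pos_INR.
  by apply: ln_le; [exact: INR_gt0|exact: INR_leq].
apply: (Rmult_le_reg_l (INR n)) => //.
have : INR n * psum n <= \sum_(0 <= p < n.+1 | prime p) (ln (INR p) * INR (n %/ p)) + theta n.
  rewrite /psum /theta -sumR_mulr -big_split; apply: leR_sum => p _ pp /=.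
  have p0 := INR_gt0 (prime_gt0 pp).
  have l0 : 0 <= ln (INR p) by apply: ln_ge0; exact: INR_ge1 (prime_gt0 pp).
  have h : INR n <= (INR (n %/ p) + 1) * INR p.
    have := INR_leq (ltnW (ltn_ceil n (prime_gt0 pp))).
    by rewrite INR_muln S_INR; lra.
  have -> : INR n * (ln (INR p) / INR p) = ln (INR p) * (INR n / INR p) by field; lra.
  suff : INR n / INR p <= INR (n %/ p) + 1 by nra.
  by apply: (Rmult_le_reg_r (INR p)) => //; rewrite /Rdiv Rmult_assoc Rinv_l; lra.
by have := ln_fact_ge n; have := theta_le n; lra.
Qed.

Lemma ln_ratio a b : 0 < a -> a <= b -> 1 - a / b <= ln b - ln a.
Proof.
move=> a0 ab; have := exp_ineq1_le (ln a - ln b).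
by rewrite exp_plus exp_Ropp !exp_ln; lra.
Qed.

Lemma isum_rec n : isum n.+1 = isum n + (if prime n.+1 then / INR n.+1 else 0).
Proof. by rewrite /isum big_mkcond big_nat_recr //= -big_mkcond. Qed.

Lemma psum_rec n : psum n.+1 = psum n + (if prime n.+1 then ln (INR n.+1) / INR n.+1 else 0).
Proof. by rewrite /psum big_mkcond big_nat_recr //= -big_mkcond. Qed.

(* Partial summation: the quantity on the left does not move when [n] passes a prime. *)
Lemma isum_psum n : (1 < n)%N ->
  isum n - psum n / ln (INR n) <= ln (ln (INR n)) - 2 / ln (INR n) + (2 / ln 2 - ln (ln 2)).
Proof.
elim: n => // n IH; rewrite leq_eqVlt => /orP[/eqP <-|n1].
  rewrite !isum_rec !psum_rec /isum /psum !sum_primes1 /= (_ : 1 + 1 = 2); last lra.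
  have := ln2_bounds => h; have -> : (0 + 0 + / 2 - (0 + 0 + ln 2 / 2) / ln 2) = 0 by field; lra.
  lra.
have {}IH := IH n1.
have a1 : INR 2 <= INR n by exact: INR_leq.
have a0 : 0 < ln (INR n).
  by rewrite -ln_1; apply: ln_increasing; rewrite /= in a1; lra.
have ab : ln (INR n) < ln (INR n.+1).
  by apply: ln_increasing; [rewrite /= in a1; lra|rewrite S_INR; lra].
have b0 : 0 < ln (INR n.+1) by lra.
have hp := psum_le (ltnW n1).
have N0 := @INR_gt0 n.+1 isT.
have -> : isum n.+1 - psum n.+1 / ln (INR n.+1) = isum n - psum n / ln (INR n.+1).
  rewrite isum_rec psum_rec; case: prime; field; lra.
have := ln_ratio a0 (Rlt_le _ _ ab).
set a := ln (INR n) in IH a0 ab hp *; set b := ln (INR n.+1) in ab b0 *.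
have i0 : 0 <= / a - / b.
  by have := Rinv_le_contravar _ _ a0 (Rlt_le _ _ ab); lra.
have := Rmult_le_compat_r _ _ _ i0 hp.
have -> : (a + 2) * (/ a - / b) = 1 - a / b + 2 / a - 2 / b by field; lra.
rewrite /Rdiv in IH *; lra.
Qed.

(** By [isum_psum] and [psum_le], [isum n] exceeds [ln (ln n)] by at most [1 + 4 + 1], and
    [exp 6 <= 3 ^ 6 = 729]. The variable [z] takes care of [n <= 1]. *)
Lemma exp_isum n z : INR n <= z -> 2 <= z -> exp (isum n) <= 729 * ln z.
Proof.
move=> nz z2; have hl := ln2_bounds.
have lz : 1 / 2 <= ln z by have := ln_le 2 z ltac:(lra) z2; lra.
case: (ltnP 1 n) => n1; last first.
  have -> : isum n = 0.
    by case: n n1 {nz} => [|[|n]] // _; rewrite ?isum_rec /isum sum_primes1 /=; lra.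
  rewrite exp_0; lra.
have n2 : 2 <= INR n by have := INR_leq n1; rewrite /=; lra.
have a0 : 1 / 2 <= ln (INR n) by have := ln_le 2 (INR n) ltac:(lra) n2; lra.
have h : isum n <= ln (ln (INR n)) + 6.
  have := isum_psum n1; have := psum_le (ltnW n1).
  set a := ln (INR n) in a0 *; set P := psum n; set S := isum n => hP hS.
  have h1 : P / a <= 1 + 2 / a.
    apply: (Rmult_le_reg_r a); first lra.
    have -> : P / a * a = P by field; lra.
    by have -> : (1 + 2 / a) * a = a + 2 by field; lra.
  have h2 : 2 / ln 2 <= 4.
    apply: (Rmult_le_reg_r (ln 2)); first lra.
    have -> : 2 / ln 2 * ln 2 = 2 by field; lra.
    lra.
  have h3 : - ln (ln 2) <= 1.
    have := ln_le (/ 2) (ln 2) ltac:(lra) ltac:(lra); rewrite ln_Rinv; lra.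
  lra.
have lnz : ln (INR n) <= ln z by apply: ln_le; lra.
apply: (@Rle_trans _ (exp (ln (ln (INR n)) + 6))).
  by case: h => [/exp_increasing|->]; lra.
rewrite exp_plus exp_ln; last lra.
have e1 := exp_le_3; have e0 := exp_pos 1.
have -> : exp 6 = exp 1 ^ 6.
  by rewrite (_ : 6 = 1 + (1 + (1 + (1 + (1 + 1))))) ?exp_plus /=; lra.
have h6 : exp 1 ^ 6 <= 3 ^ 6 by apply: pow_incr; lra.
have : 0 <= exp 1 ^ 6 by apply: pow_le; lra.
rewrite (_ : 3 ^ 6 = 729) in h6; last by rewrite /=; lra.
nra.
Qed.

(** With [q = / (p + 1)] one has [q / (1 - q) = / p]: a squarefree integer gets a probability
    proportional to its inverse. *)
Definition qpr (p : nat) : R := if prime p then / (INR p + 1) else 0.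

Lemma qpr_ge0 p : 0 <= qpr p.
Proof.
rewrite /qpr; case: prime; last lra.
by apply: Rlt_le; apply: Rinv_0_lt_compat; have := pos_INR p; lra.
Qed.

Lemma qpr_le p : qpr p <= 1 / 3.
Proof.
rewrite /qpr; case: (boolP (prime p)) => [/prime_gt1 pp|_]; last lra.
rewrite /Rdiv Rmult_1_l; apply: Rinv_le_contravar; first lra.
by have := INR_leq pp; rewrite /=; lra.
Qed.

Lemma qpr_le_inv p : prime p -> qpr p <= / INR p.
Proof.
move=> pp; rewrite /qpr pp; have := INR_gt0 (prime_gt0 pp) => p0.
by apply: Rinv_le_contravar; lra.
Qed.

Lemma lam_qpr_le m : lam qpr m <= exp (isum m).
Proof.
elim: m => [|m IH] /=; first by rewrite /isum sum_primes1 /= exp_0; lra.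
rewrite isum_rec exp_plus.
apply: Rmult_le_compat => //; first exact/Rlt_le/(lam_gt0 qpr_ge0).
  by have := qpr_ge0 m.+1; lra.
case: (boolP (prime m.+1)) => pp; last by rewrite /qpr (negbTE pp) exp_0; lra.
have := qpr_le_inv pp; have := exp_ineq1_le (/ INR m.+1); lra.
Qed.

Lemma sumR_support (F : nat -> R) a b c : (forall k, 0 <= F k) ->
  (forall k, (b <= k)%N -> F k = 0) -> \sum_(a <= k < c) F k <= \sum_(0 <= k < b) F k.
Proof.
move=> F0 Fb; case: (leqP c a) => [ca|ac]; first by rewrite big_geq //; apply: sumR_ge0.
have [W bW cW] : exists2 W, (b <= W)%N & (c <= W)%N.
  by exists (b + c)%N; rewrite ?leq_addr ?leq_addl.
have h1 : \sum_(a <= k < c) F k <= \sum_(0 <= k < W) F k.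
  rewrite [X in _ <= X](@big_cat_nat _ _ _ a) /=; [|lia|lia].
  rewrite [X in _ <= _ + X](@big_cat_nat _ _ _ c) /=; [|lia|lia].
  have s0 r : 0 <= \sum_(k <- r) F k by apply: sumR_ge0.
  by have := s0 (index_iota 0 a); have := s0 (index_iota c W); lra.
apply: Rle_trans h1 _; rewrite (@big_cat_nat _ _ _ b) //=.
rewrite [X in _ + X]big1_seq; first lra.
by move=> k /=; rewrite mem_index_iota => /andP[/Fb].
Qed.

Definition flr (x : R) : nat := Z.to_nat (Int_part x).

Lemma flr_bounds x : 0 <= x -> INR (flr x) <= x < INR (flr x) + 1.
Proof.
move=> x0; have [h1 h2] := base_Int_part x.
have z0 : (0 <= Int_part x)%Z.
  by have : (-1 < Int_part x)%Z; [apply: lt_IZR; lra|lia].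
rewrite /flr INR_IZR_INZ Z2Nat.id //; lra.
Qed.

(* Primes are replaced by the integer parts of [G ln p], so that the divisors of an
   integer become subset sums on a grid of mesh [1 / G]. *)
Definition grid (G p : nat) : nat := flr (INR G * ln (INR p)).

Lemma grid_bounds G p : (0 < p)%N ->
  INR (grid G p) <= INR G * ln (INR p) < INR (grid G p) + 1.
Proof.
move=> p0; apply: flr_bounds; apply: Rmult_le_pos; first exact: pos_INR.
by apply: ln_ge0; exact: INR_ge1.
Qed.

(** All primes involved lie in [[z, 27 z]] with [z >= m + 1]. There [1 / p <= ln p / (z ln z)], so
    Chebyshev's bound gives [54 / ln z], while [lam m <= 729 * ln z]; the constant is [54 * 729]. *)
Lemma grid_window G m M v w : (0 < G)%N ->
  \sum_(m <= p < M | near G (v + grid G p.+1) w) qpr p.+1 <= 39366 / lam qpr m.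
Proof.
move=> G0; have G1 := INR_ge1 G0; have hl := ln2_bounds.
(* [a] is the value aimed at by [ln p]; the tolerance of [near] and the rounding confine [ln p] to
   [[a - 1, a + 2]], and [exp 3 <= 27]. *)
pose a := (INR w - INR v) / INR G; pose y := exp (a - 1).
pose z := Rmax 2 (Rmax (INR m.+1) y); pose n := flr (27 * z).
have z2 : 2 <= z by apply: Rmax_l.
have zm : INR m.+1 <= z by apply: Rle_trans (Rmax_l _ _) (Rmax_r _ _).
have zy : y <= z by apply: Rle_trans (Rmax_r _ _) (Rmax_r _ _).
have lz : 1 / 2 <= ln z by have := ln_le 2 z ltac:(lra) z2; lra.
have [hn hn'] := @flr_bounds (27 * z) ltac:(lra); rewrite -/n in hn hn'.
pose t := / (z * ln z); have t0 : 0 < t by apply: Rinv_0_lt_compat; nra.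
pose F k := if prime k && (k < n.+1)%N then ln (INR k) * t else 0.
have F0 k : 0 <= F k.
  rewrite /F; case: andP => [[/prime_gt0 k0 _]|_]; last lra.
  by apply: Rmult_le_pos; [apply: ln_ge0; exact: INR_ge1|lra].
have key p : (m <= p)%N -> near G (v + grid G p.+1) w -> qpr p.+1 <= F p.+1.
  move=> mp /andP[/INR_leq h1 /INR_leq h2].
  case: (boolP (prime p.+1)) => pp; last by rewrite /qpr (negbTE pp); exact: F0.
  rewrite !INR_addn in h1 h2; have [g1 g2] := grid_bounds G (prime_gt0 pp).
  set k := p.+1 in pp h1 h2 g1 g2 *; have k0 := INR_gt0 (prime_gt0 pp).
  have aE : INR w - INR v = a * INR G by rewrite /a; field; lra.
  have l1 : a - 1 <= ln (INR k) by apply: (Rmult_le_reg_l (INR G)); lra.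
  have l2 : ln (INR k) <= (a - 1) + (1 + (1 + 1)) by apply: (Rmult_le_reg_l (INR G)); lra.
  have ky : y <= INR k.
    by rewrite -(exp_ln _ k0); case: l1 => [/exp_increasing|<-]; rewrite /y; lra.
  have ky' : INR k <= 27 * y.
    rewrite -(exp_ln _ k0); apply: (@Rle_trans _ (exp ((a - 1) + (1 + (1 + 1))))).
      by case: l2 => [/exp_increasing|->]; lra.
    rewrite exp_plus -/y; have e1 := exp_le_3; have e0 := exp_pos 1.
    have y0 : 0 < y by exact: exp_pos.
    have : exp (1 + (1 + 1)) <= 27 by rewrite !exp_plus; nra.
    nra.
  have kn : (k < n.+1)%N.
    rewrite ltnS; apply: leq_INR; apply: Rnot_lt_le => h.
    have : (n.+1 <= k)%N by rewrite ltnNge; apply/negP => /INR_leq; lra.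
    by move=> /INR_leq; rewrite S_INR; lra.
  have kz : z <= INR k.
    apply: Rmax_lub; first by have := INR_leq (prime_gt1 pp); rewrite /=; lra.
    by apply: Rmax_lub => //; apply: INR_leq.
  rewrite /F pp kn /=; apply: Rle_trans (qpr_le_inv pp) _.
  have lk : ln z <= ln (INR k) by apply: ln_le; lra.
  have iz : / INR k <= / z by apply: Rinv_le_contravar; lra.
  have -> : ln (INR k) * t = / z * (ln (INR k) / ln z) by rewrite /t; field; lra.
  have r1 : 1 <= ln (INR k) / ln z.
    by apply: (Rmult_le_reg_r (ln z)); rewrite /Rdiv ?Rmult_assoc ?Rinv_l; lra.
  have : 0 < / z by apply: Rinv_0_lt_compat; lra.
  nra.
apply: (@Rle_trans _ (\sum_(m <= p < M) F p.+1)).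
  rewrite [X in X <= _]big_mkcond; apply: leR_sum => p; rewrite mem_index_iota => /andP[mp _] _.
  by case: ifP => // /(key _ mp).
have -> : \sum_(m <= p < M) F p.+1 = \sum_(m.+1 <= k < M.+1) F k by rewrite [RHS]big_add1.
apply: Rle_trans (@sumR_support F m.+1 n.+1 M.+1 F0 _) _.
  by move=> k nk; rewrite /F ltnNge nk andbF.
have -> : \sum_(0 <= k < n.+1) F k = theta n * t.
  rewrite /theta -sumR_mull [RHS]big_mkcond; apply: eq_big_nat => k /andP[_ kn].
  by rewrite /F kn andbT.
have l0 := lam_gt0 qpr_ge0 m.
have hlam : lam qpr m <= 729 * ln z.
  apply: Rle_trans (lam_qpr_le m) _; apply: exp_isum => //.
  by apply: Rle_trans zm; exact: INR_leq.
have h54 : theta n * t <= 54 / ln z.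
  have -> : 54 / ln z = 54 * z * t by rewrite /t; field; lra.
  by apply: Rmult_le_compat_r; [lra|have := theta_le n; lra].
apply: Rle_trans h54 _.
apply: (Rmult_le_reg_r (ln z * lam qpr m)); first by apply: Rmult_lt_0_compat; lra.
have -> : 54 / ln z * (ln z * lam qpr m) = 54 * lam qpr m by field; lra.
have -> : 39366 / lam qpr m * (ln z * lam qpr m) = 54 * (729 * ln z) by field; lra.
lra.
Qed.

(** * From integers to lists of primes *)

(** These lists encode, through [prodl], the squarefree integers with all primes at most [P], in the
    decreasing order in which [Ex] builds its lists. *)
Fixpoint plists (P : nat) : seq (seq nat) :=
  if P is P'.+1 then plists P' ++ (if prime P then map (cons P) (plists P') else [::])
  else [:: [::]].

Definition prodl (n : seq nat) : nat := \prod_(p <- n) p.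

Lemma prodl_cons p n : prodl (p :: n) = (p * prodl n)%N.
Proof. by rewrite /prodl big_cons. Qed.

Lemma path_plists P n : n \in plists P -> path gtn P.+1 n && all prime n.
Proof.
elim: P n => [|P IH] n /=; first by rewrite inE => /eqP ->.
rewrite mem_cat => /orP[/IH|].
  by case: n => [|p n] //= /andP[/andP[h ->] ->]; rewrite andbT (ltn_trans h).
case: ifP => // pP /mapP[n' /IH /andP[h1 h2] ->] /=.
by rewrite ltnSn h1 pP h2.
Qed.

Lemma plists_path P n : path gtn P.+1 n -> all prime n -> n \in plists P.
Proof.
elim: P n => [|P IH] n /=; first by case: n => [|[|[|p]] n].
move=> pn an; rewrite mem_cat; case: n pn an => [|p n] /=.
  by move=> _ _; rewrite IH.
move=> /andP[pP pn] /andP[pp an]; move: pP; rewrite ltnS leq_eqVlt => /orP[/eqP e|pP].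
  by rewrite -e pp map_f ?orbT //; apply: IH => //; rewrite -e.
by rewrite IH //= ?pP // pp.
Qed.

Lemma plists_gt0 P n : n \in plists P -> (0 < prodl n)%N.
Proof.
move=> /path_plists /andP[_ /allP h]; rewrite /prodl big_seq.
by apply: prodn_cond_gt0 => p /h /prime_gt0.
Qed.

Lemma size_plists P n : n \in plists P -> (size n <= P)%N.
Proof.
elim: P n => [|P IH] n /=; first by rewrite inE => /eqP ->.
rewrite mem_cat => /orP[/IH/leqW //|].
by case: ifP => // _ /mapP[n' /IH h ->].
Qed.

Lemma plists_le P n p : n \in plists P -> p \in n -> (p <= P)%N.
Proof.
move=> /path_plists /andP[/= h _].
have tr : transitive gtn by move=> a b c /= ab bc; apply: ltn_trans bc ab.
by move/(order_path_min tr)/allP: h => h /h.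
Qed.

Lemma sum_plists_rec P (F : seq nat -> R) :
  \sum_(n <- plists P.+1) F n = \sum_(n <- plists P) F n +
    (if prime P.+1 then \sum_(n <- plists P) F (P.+1 :: n) else 0).
Proof.
rewrite /= big_cat /=; congr (_ + _); case: ifP => _; last by rewrite big_nil.
by rewrite big_map.
Qed.

(** [exp (isum P)] majorizes the product of the [1 + / p], which is the normalizing constant of the
    law given by [qpr]. *)
Lemma sum_plists_le P (f : seq nat -> R) : (forall n, 0 <= f n) ->
  \sum_(n <- plists P) (f n / INR (prodl n)) <= exp (isum P) * Ex qpr P f.
Proof.
elim: P f => [|P IH] f f0.
  by rewrite /= big_seq1 /prodl big_nil /isum sum_primes1 exp_0 /=; lra.
rewrite sum_plists_rec isum_rec exp_plus [Ex _ _ _]/=.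
have E0 g : (forall n, 0 <= g n) -> 0 <= Ex qpr P g.
  by move=> g0; apply: (Ex_ge0 qpr_ge0 qpr_le).
have e0 := exp_pos (isum P).
case: (boolP (prime P.+1)) => pp; cbv iota; last first.
  have -> : qpr P.+1 = 0 by rewrite /qpr (negbTE pp).
  by rewrite exp_0; have := IH f f0; lra.
have k0 := INR_gt0 (prime_gt0 pp).
have -> : \sum_(n <- plists P) (f (P.+1 :: n) / INR (prodl (P.+1 :: n))) =
   / INR P.+1 * \sum_(n <- plists P) (f (P.+1 :: n) / INR (prodl n)).
  rewrite -sumR_mulr; apply: eq_big_seq => n /plists_gt0/INR_gt0 n0.
  by rewrite prodl_cons INR_muln; field; lra.
have h1 := IH f f0; have h2 := IH (fun n => f (P.+1 :: n)) (fun n => f0 _).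
have x0 := E0 f f0; have y0 := E0 (fun n => f (P.+1 :: n)) (fun n => f0 _).
have -> : qpr P.+1 = / (INR P.+1 + 1) by rewrite /qpr pp.
move: h1 h2 x0 y0; set x := Ex qpr P f; set y := Ex qpr P _.
set s1 := \big[_/_]_(_ <- _) _; set s2 := \big[_/_]_(_ <- _) _ => h1 h2 x0 y0.
have i0 : 0 < / INR P.+1 by apply: Rinv_0_lt_compat.
set k := INR P.+1 in k0 i0 *.
have := exp_ineq1_le (/ k) => he.
have z0 : 0 <= (1 - / (k + 1)) * x + / (k + 1) * y.
  have : 0 < / (k + 1) by apply: Rinv_0_lt_compat; lra.
  have : / (k + 1) <= / 1 by apply: Rinv_le_contravar; lra.
  by rewrite Rinv_1 => a b; apply: Rplus_le_le_0_compat; apply: Rmult_le_pos; lra.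
apply: (@Rle_trans _ (exp (isum P) * (x + / k * y))).
  by have := Rmult_le_compat_l _ _ _ (Rlt_le _ _ i0) h2; lra.
rewrite Rmult_assoc; apply: Rmult_le_compat_l; first lra.
apply: (@Rle_trans _ ((1 + / k) * ((1 - / (k + 1)) * x + / (k + 1) * y))).
  by apply: Req_le; field; lra.
by apply: Rmult_le_compat_r.
Qed.

(** Removing [p] is injective on the lists that contain it. *)
Lemma sum_plists_rem P p (F : seq nat -> R) : (forall n, 0 <= F n) ->
  \sum_(n <- plists P) (if p \in n then F (rem p n) else 0) <= \sum_(n <- plists P) F n.
Proof.
elim: P F => [|P IH] F F0; first by rewrite /= !big_seq1.
rewrite !sum_plists_rec; have IH1 := IH F F0.
case: (boolP (prime P.+1)) => pp; last by lra.
case: (eqVneq p P.+1) => [->|pP].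
  have -> : \sum_(n <- plists P) (if P.+1 \in n then F (rem P.+1 n) else 0) = 0.
    by rewrite big1_seq // => n /= nP; case: ifP => // /(plists_le nP); rewrite ltnn.
  rewrite (@eq_bigr _ _ _ _ _ _ _ F) => [|n _]; last by rewrite mem_head /= eqxx.
  have : 0 <= \sum_(n <- plists P) F (P.+1 :: n) by apply: sumR_ge0.
  lra.
have := IH (fun n => F (P.+1 :: n)) (fun n => F0 _).
rewrite [X in _ -> _ + X <= _](eq_bigr (fun n => if p \in n then F (P.+1 :: rem p n) else 0)); first by move=> h; exact: Rplus_le_compat IH1 h.
by move=> n _; rewrite inE (negbTE pP) /= eq_sym (negbTE pP).
Qed.

Lemma ln_prodl n : all (leq 1) n -> ln (INR (prodl n)) = \sum_(p <- n) ln (INR p).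
Proof. by move=> /allP h; rewrite /prodl ln_INR_prod // => p /h. Qed.

(* [ln (prodl n)] is the sum of [ln p] over [p] in [n]; removing [p] from [n] leaves a
   sum over primes [p <= N / (a * prodl n)], to which Chebyshev's bound applies. *)
Lemma sum_plists_ln N a (h : seq nat -> R) : (0 < a)%N -> (forall n, 0 <= h n) ->
  (forall n p, p \in n -> h n <= 2 * h (rem p n)) ->
  \sum_(n <- plists N | (a * prodl n <= N)%N) (h n * ln (INR (prodl n))) <=
  4 * (INR N / INR a) * \sum_(n <- plists N) (h n / INR (prodl n)).
Proof.
move=> a0 h0 hrem; have A0 := INR_gt0 a0.
pose T p n := if (a * (p * prodl n) <= N)%N then 2 * h n * ln (INR p) else 0.
have T0 p n : (0 < p)%N -> 0 <= T p n.
  move=> p0; rewrite /T; case: ifP => _; last lra.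
  by apply: Rmult_le_pos; [have := h0 n; lra|apply: ln_ge0; exact: INR_ge1].
apply: (@Rle_trans _ (\sum_(n <- plists N) \sum_(0 <= p < N.+1 | prime p)
    (if p \in n then T p (rem p n) else 0))).
  rewrite big_mkcond; apply: leR_sum => n nP _; case: ifP => hn; last first.
    by apply: sumR_ge0 => p _ pp; case: ifP => _; [exact: T0 (prime_gt0 pp)|lra].
  have := path_plists nP => /andP[pn /allP an].
  have un : uniq n.
    have tr : transitive gtn by move=> x y z /= xy yz; apply: ltn_trans yz xy.
    apply: (sorted_uniq tr); first by move=> x /=; rewrite ltnn.
    exact: path_sorted pn.
  rewrite ln_prodl; last by apply/allP => p /an /prime_gt0.
  rewrite -sumR_mulr -big_mkcondr /=.
  have -> : \sum_(0 <= p < N.+1 | prime p && (p \in n)) T p (rem p n) = \sum_(p <- n) T p (rem p n).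
    rewrite -big_filter; apply: perm_big.
    apply: uniq_perm; rewrite ?filter_uniq ?iota_uniq // => p.
    rewrite mem_filter mem_index_iota.
    case: (boolP (p \in n)) => pn'; last by rewrite andbF.
    by rewrite an // ltnS (plists_le nP pn').
  apply: leR_sum => p pn' _; rewrite /T.
  have -> : (p * prodl (rem p n))%N = prodl n by rewrite /prodl [in RHS](big_rem p) .
  rewrite hn; have := hrem n p pn'; have l0 : 0 <= ln (INR p).
    by apply: ln_ge0; apply: INR_ge1; apply: prime_gt0 (an _ pn').
  by move=> hh; apply: Rmult_le_compat_r.
rewrite exchange_big /=.
apply: (@Rle_trans _ (\sum_(0 <= p < N.+1 | prime p) \sum_(n <- plists N) T p n)).
  apply: leR_sum => p _ pp; apply: sum_plists_rem => n.
  exact: T0 (prime_gt0 pp).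
rewrite exchange_big -sumR_mulr; apply: leR_sum => n nP _.
have n0 := plists_gt0 nP; have N0 := INR_gt0 n0; set d := (a * prodl n)%N.
have d0 : (0 < d)%N by rewrite muln_gt0 a0.
apply: (@Rle_trans _ (2 * h n * theta (N %/ d))).
  rewrite /theta -sumR_mulr [X in X <= _]big_mkcond [X in _ <= X]big_mkcond /=.
  pose F p := if prime p && (p * d <= N)%N then 2 * h n * ln (INR p) else 0.
  rewrite (@eq_bigr _ _ _ _ _ _ _ F); last first.
    by move=> p _; rewrite /F /T mulnCA; case: (prime p).
  apply: Rle_trans (@sumR_support F 0 (N %/ d).+1 N.+1 _ _) _.
  - move=> p; rewrite /F; case: (boolP (prime p)) => [/prime_gt0 pp|_] /=; last lra.
    case: ifP => _; last lra.
    by apply: Rmult_le_pos; [have := h0 n; lra|apply: ln_ge0; exact: INR_ge1].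
  - by move=> p; rewrite ltn_divLR // /F => hp; rewrite leqNgt hp andbF.
  apply: leR_sum => p; rewrite mem_index_iota ltnS /= leq_divRL // => hp _.
  by rewrite /F hp andbT; lra.
have -> : 4 * (INR N / INR a) * (h n / INR (prodl n)) = 2 * h n * (2 * (INR N / INR d)).
  by rewrite /d INR_muln; field; lra.
have h2 : 0 <= 2 * h n by have := h0 n; lra.
apply: Rmult_le_compat_l => //; apply: Rle_trans (theta_le _) _.
apply: Rmult_le_compat_l; first lra.
have D0 := INR_gt0 d0; apply: (Rmult_le_reg_r (INR d)) => //.
have -> : INR N / INR d * INR d = INR N by field; lra.
by rewrite -INR_muln; apply: INR_leq; exact: leq_trunc_div.
Qed.

Section CountRem.
Variables (l : nat -> nat) (G : nat).
Hypothesis G_gt0 : (0 < G)%N.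
Local Open Scope nat_scope.

Lemma cntsh_cons p n a w :
  cntsh l G (p :: n) a w = cntsh l G n a w + cntsh l G n (a + l p) w.
Proof.
rewrite /cntsh /= count_cat count_map; congr addn.
by apply: eq_count => d /=; rewrite ell_cons addnA.
Qed.

Lemma cntsh_rem p n a w : p \in n ->
  cntsh l G n a w = cntsh l G (rem p n) a w + cntsh l G (rem p n) (a + l p) w.
Proof.
elim: n a => // x n IH a; rewrite inE /=; case: (eqVneq p x) => [<- _|px /= pn].
  by rewrite cntsh_cons.
by rewrite !cntsh_cons !IH // addnACA (addnAC a (l x)).
Qed.

Lemma cntsh_le_cmax n a w : cntsh l G n a w <= cmax l G n.
Proof.
case: (ltnP w a) => wa; first by rewrite cntsh_lt.
by rewrite -(subnK wa) cntsh_addr //; apply: cmax_sup.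
Qed.

(** The sublists without [p] and those with [p] are each counted by one window of the shorter
    list. *)
Lemma cmax_rem n p : p \in n -> cmax l G n <= 2 * cmax l G (rem p n).
Proof.
move=> pn; apply: cmax_le => w.
have -> : cnt l G n w = cntsh l G n 0 w by rewrite -[in RHS](addn0 w) cntsh_addr.
by rewrite (cntsh_rem 0 w pn) mul2n -addnn; apply: leq_add; exact: cntsh_le_cmax.
Qed.

End CountRem.

(** * Divisor sums for the square part *)

Definition ndiv (k : nat) : nat := size (divisors k).

Lemma divisor_split d a b : (0 < a)%N -> (d %| a * b)%N ->
  exists g e, [/\ (g %| a)%N, (e %| b)%N & d = (g * e)%N].
Proof.
move=> a0 dab; exists (gcdn d a), (d %/ gcdn d a)%N.
have g0 : (0 < gcdn d a)%N by rewrite gcdn_gt0 a0 orbT.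
rewrite dvdn_gcdr mulnC divnK ?dvdn_gcdl //; split=> //.
have co : coprime (d %/ gcdn d a) (a %/ gcdn d a).
  by rewrite /coprime -(eqn_pmul2r g0) mul1n muln_gcdl !divnK ?dvdn_gcdl ?dvdn_gcdr.
rewrite -(Gauss_dvdr _ co) -(dvdn_pmul2r g0) mulnAC !divnK ?dvdn_gcdl ?dvdn_gcdr //.
Qed.

Lemma ndivM a b : (0 < a)%N -> (0 < b)%N -> (ndiv (a * b) <= ndiv a * ndiv b)%N.
Proof.
move=> a0 b0; rewrite /ndiv -(size_allpairs muln); apply: uniq_leq_size.
  exact: divisors_uniq.
move=> d; rewrite -dvdn_divisors ?muln_gt0 ?a0 // => /(divisor_split a0)[g [e [ga eb ->]]].
by apply/allpairsP; exists (g, e); rewrite -!dvdn_divisors.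
Qed.

Lemma sum_eq_le1 (r : seq nat) (a : nat) (x : R) : uniq r -> 0 <= x ->
  \sum_(k <- r) (if k == a then x else 0) <= x.
Proof.
move=> ur x0; rewrite -big_mkcond; case: (boolP (a \in r)) => ar.
  by rewrite (big_rem a) //= eqxx big1_seq => [|k /andP[/eqP ->]]; [lra|rewrite mem_rem_uniq // inE eqxx].
by rewrite big1_seq // => k /andP[/eqP ->]; rewrite (negbTE ar).
Qed.

Lemma sum_ndiv N (f : nat -> R) : (forall k, 0 <= f k) ->
  \sum_(1 <= k < N.+1) (f k * INR (ndiv k)) <=
  \sum_(1 <= a < N.+1) \sum_(1 <= c < N.+1) f (a * c)%N.
Proof.
move=> f0.
have key k : k \in index_iota 1 N.+1 -> f k * INR (ndiv k) <=
   \sum_(1 <= a < N.+1) \sum_(1 <= c < N.+1) (if k == (a * c)%N then f (a * c)%N else 0).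
  rewrite mem_index_iota ltnS => /andP[k0 kN].
  have s0 a : 0 <= \sum_(1 <= c < N.+1) (if k == (a * c)%N then f (a * c)%N else 0).
    by apply: sumR_ge0 => c _ _; case: ifP => _; [exact: f0|lra].
  rewrite Rmult_comm /ndiv -sumR_const.
  apply: (@Rle_trans _ (\sum_(a <- divisors k) \sum_(1 <= c < N.+1) (if k == (a * c)%N then f (a * c)%N else 0))).
    apply: leR_sum => a; rewrite -dvdn_divisors // => ak _.
    have cI : (k %/ a)%N \in index_iota 1 N.+1.
      rewrite mem_index_iota divn_gt0 ?(dvdn_leq k0) //=; last by apply: dvdn_gt0 ak.
      by rewrite ltnS (leq_trans (leq_div _ _)).
    have := @leR_sum_term _ _ (fun c => if k == (a * c)%N then f (a * c)%N else 0) _ cI.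
    rewrite [(a * (k %/ a))%N]mulnC divnK // eqxx; apply=> c _.
    by case: ifP => _; [exact: f0|lra].
  have -> : \sum_(a <- divisors k) \sum_(1 <= c < N.+1) (if k == (a * c)%N then f (a * c)%N else 0) =
    \sum_(1 <= a < N.+1 | (a %| k)%N) \sum_(1 <= c < N.+1) (if k == (a * c)%N then f (a * c)%N else 0).
    rewrite -[RHS]big_filter; apply: perm_big; apply: uniq_perm.
    - exact: divisors_uniq.
    - by rewrite filter_uniq // iota_uniq.
    move=> a; rewrite mem_filter mem_index_iota -dvdn_divisors //.
    case: (boolP (a %| k)%N) => //= ak.
    by rewrite (dvdn_gt0 k0 ak) ltnS (leq_trans (dvdn_leq k0 ak)).
  by apply: sumR_subset => //.
apply: (@Rle_trans _ (\sum_(1 <= k < N.+1) \sum_(1 <= a < N.+1) \sum_(1 <= c < N.+1)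
   (if k == (a * c)%N then f (a * c)%N else 0))).
  by apply: leR_sum => k kI _; exact: key.
rewrite exchange_big; apply: leR_sum => a _ _; rewrite exchange_big; apply: leR_sum => c _ _.
by apply: sum_eq_le1 => //; exact: iota_uniq.
Qed.

(** This is [k ^ (- 3 / 2)]: of the [k ^ (- 2)] that a square part offers, a factor [sqrt k] is
    given up to absorb [ln k]. *)
Definition w32 (k : nat) : R := / (INR k * sqrt (INR k)).

Lemma w32_ge0 k : 0 <= w32 k.
Proof.
rewrite /w32; case: k => [|k]; first by rewrite /= Rmult_0_l Rinv_0; lra.
have h := @INR_gt0 k.+1 isT; have := sqrt_lt_R0 _ h => s.
by apply: Rlt_le; apply: Rinv_0_lt_compat; nra.
Qed.

Lemma w32M a b : w32 (a * b) = w32 a * w32 b.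
Proof.
rewrite /w32 INR_muln sqrt_mult; try exact: pos_INR.
by rewrite -Rinv_mult; congr (/ _); lra.
Qed.

Lemma sum_w32 N : \sum_(1 <= k < N.+1) w32 k <= 3.
Proof.
case: N => [|N]; first by rewrite big_geq //; lra.
suff h : \sum_(1 <= k < N.+2) w32 k <= 3 - 2 / sqrt (INR N.+1).
  have h1 := sqrt_lt_R0 _ (@INR_gt0 N.+1 isT).
  have : 0 < 2 / sqrt (INR N.+1) by apply: Rdiv_lt_0_compat; lra.
  lra.
elim: N => [|N IH]; first by rewrite big_nat1 /w32 /= sqrt_1 Rmult_1_r Rinv_1; lra.
rewrite big_nat_recr //=; apply: (@Rle_trans _ (3 - 2 / sqrt (INR N.+1) + w32 N.+2)).
  by apply: Rplus_le_compat_r.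
have s0 := sqrt_lt_R0 _ (@INR_gt0 N.+1 isT); have t0 := sqrt_lt_R0 _ (@INR_gt0 N.+2 isT).
have s2 := sqrt_sqrt _ (pos_INR N.+1); have t2 := sqrt_sqrt _ (pos_INR N.+2).
rewrite S_INR in t2; rewrite /w32 -{1}(sqrt_sqrt _ (pos_INR N.+2)).
move: s0 t0 s2 t2; set s := sqrt (INR N.+1); set t := sqrt (INR N.+2) => s0 t0 s2 t2.
have st : s < t by nra.
suff : / (t * t * t) <= 2 / s - 2 / t by lra.
have -> : 2 / s - 2 / t = 2 * (t * t - s * s) / (s * t * (s + t)) by field; lra.
rewrite (_ : t * t - s * s = 1); last lra.
apply: (Rmult_le_reg_r (t * t * t * (s * t * (s + t)))); first by do !apply: Rmult_lt_0_compat; lra.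
have -> : / (t * t * t) * (t * t * t * (s * t * (s + t))) = s * t * (s + t) by field; lra.
have -> : 2 * 1 / (s * t * (s + t)) * (t * t * t * (s * t * (s + t))) = 2 * (t * t * t).
  by field; lra.
have : 0 <= t * ((t - s) * (2 * t + s)) by do !apply: Rmult_le_pos; lra.
lra.
Qed.

Lemma sum_ndiv_w32 N : \sum_(1 <= k < N.+1) (w32 k * INR (ndiv k)) <= 9.
Proof.
apply: Rle_trans (sum_ndiv N w32_ge0) _.
have -> : \sum_(1 <= a < N.+1) \sum_(1 <= c < N.+1) w32 (a * c) =
  (\sum_(1 <= a < N.+1) w32 a) * (\sum_(1 <= c < N.+1) w32 c).
  by rewrite -sumR_mull; apply: eq_bigr => a _; rewrite -sumR_mulr; apply: eq_bigr => c _; exact: w32M.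
have := sum_w32 N; have : 0 <= \sum_(1 <= k < N.+1) w32 k by apply: sumR_ge0 => k _ _; exact: w32_ge0.
nra.
Qed.

(** One factor [ndiv k] is expanded over the factorizations [k = a * c]; the other is
    submultiplicative, so the sum is at most the square of the preceding one. *)
Lemma sum_ndiv2_w32 N : \sum_(1 <= k < N.+1) (w32 k * INR (ndiv k) ^ 2) <= 81.
Proof.
have f0 k : 0 <= w32 k * INR (ndiv k).
  by apply: Rmult_le_pos; [exact: w32_ge0|exact: pos_INR].
have -> : \sum_(1 <= k < N.+1) (w32 k * INR (ndiv k) ^ 2) =
   \sum_(1 <= k < N.+1) (w32 k * INR (ndiv k) * INR (ndiv k)).
  by apply: eq_bigr => k _; rewrite /=; lra.
apply: Rle_trans (sum_ndiv N f0) _.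
apply: (@Rle_trans _ (\sum_(1 <= a < N.+1) \sum_(1 <= c < N.+1)
   (w32 a * INR (ndiv a) * (w32 c * INR (ndiv c))))).
  apply: leR_sum => a; rewrite mem_index_iota => /andP[a0 _] _.
  apply: leR_sum => c; rewrite mem_index_iota => /andP[c0 _] _.
  rewrite w32M; have := INR_leq (ndivM a0 c0); rewrite INR_muln => h.
  have := Rmult_le_compat_l _ _ _ (Rmult_le_pos _ _ (w32_ge0 a) (w32_ge0 c)) h; lra.
under eq_bigr do rewrite sumR_mulr.
rewrite sumR_mull; have := sum_ndiv_w32 N.
have : 0 <= \sum_(1 <= k < N.+1) (w32 k * INR (ndiv k)) by apply: sumR_ge0.
by move=> s0 s9; rewrite (_ : 81 = 9 * 9); [apply: Rmult_le_compat|lra].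
Qed.
Lemma square_primes_decomp N m : (0 < m <= N)%N ->
  exists k n, [/\ (0 < k <= N)%N, n \in plists N & m = (k ^ 2 * prodl n)%N].
Proof.
move=> /andP[m0 mN].
pose k := (\prod_(p <- primes m) p ^ (logn p m)./2)%N.
pose n := [seq p <- rev (primes m) | odd (logn p m)].
have mE : m = (k ^ 2 * prodl n)%N.
  rewrite [LHS]prod_prime_decomp // prime_decompE big_map /= /k expnS expn1.
  rewrite /prodl /n big_filter [X in (_ * X)%N](perm_big (primes m)) /=; last by rewrite perm_rev.
  rewrite [X in (_ * X)%N]big_mkcond -!big_split /=; apply: eq_bigr => p _.
  rewrite -{1}(odd_double_half (logn p m)) expnD -addnn expnD mulnC.
  by case: odd; rewrite ?expn1.
have k0 : (0 < k)%N by apply: contraTT m0; rewrite -!leqNgt leqn0 => /eqP k0; rewrite mE k0.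
have n0 : (0 < prodl n)%N by apply: contraTT m0; rewrite -!leqNgt leqn0 => /eqP n0; rewrite mE n0 muln0.
exists k, n; split=> //; first by rewrite k0; nia.
have an : all (fun p => prime p && (p <= N)%N) n.
  apply/allP => p; rewrite mem_filter mem_rev mem_primes => /and4P[_ -> _ pm].
  by rewrite (leq_trans (dvdn_leq m0 pm)).
apply: plists_path; last by apply: sub_all an => p /andP[].
have tr : transitive gtn by move=> x y z /= xy yz; apply: ltn_trans yz xy.
rewrite (path_sortedE tr); apply/andP; split.
  by apply: sub_all an => p /andP[_] /=; rewrite ltnS.
apply: (sorted_filter tr); rewrite rev_sorted; exact: sorted_primes.
Qed.

(** * From divisors in a window to windows on the grid *)

Definition inwin (u : R) (d : nat) : bool :=
  (if Rlt_dec (exp u) (INR d) then true else false) &&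
  (if Rle_dec (INR d) (exp (u + 1)) then true else false).

Lemma inwinP u d : reflect (exp u < INR d <= exp (u + 1)) (inwin u d).
Proof.
rewrite /inwin; case: Rlt_dec => h1; case: Rle_dec => h2 /=; constructor; tauto.
Qed.

Lemma seq_iota a m : List.seq a m = iota a m.
Proof. by elim: m a => //= m IH a; rewrite IH. Qed.

Lemma modn_modulo m d : (m %% d)%N = Nat.modulo m d.
Proof.
case: d => // d; apply: (Nat.mod_unique _ _ (m %/ d.+1)); first by apply/ltP; exact: ltn_pmod.
by rewrite [in LHS](divn_eq m d.+1) mulnC.
Qed.

Lemma length_filter (T : Type) (f g : pred T) s :
  f =1 g -> length (List.filter f s) = size (filter g s).
Proof. by move=> fg; elim: s => //= x s IH; rewrite fg; case: ifP => _ /=; rewrite IH. Qed.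

Lemma Delta_uE m u : (0 < m)%N ->
  Delta_u m u = size [seq d <- iota 1 m | (d %| m) && inwin u d].
Proof.
move=> m0; rewrite /Delta_u seq_iota; apply: length_filter => d.
have -> : Nat.eqb (m mod d) 0 = (d %| m)%N.
  by rewrite /dvdn modn_modulo; apply/Nat.eqb_spec/eqP.
by rewrite -andbA /inwin; case: Rlt_dec; case: Rle_dec.
Qed.

Lemma dvd_prodl n e : all prime n -> (e %| prodl n)%N ->
  exists2 s, s \in sublists n & e = prodl s.
Proof.
elim: n e => [|p n IH] e /=.
  by rewrite /prodl big_nil dvdn1 => _ /eqP ->; exists [::]; rewrite ?mem_head ?big_nil.
move=> /andP[pp an]; rewrite prodl_cons => /(divisor_split (prime_gt0 pp))[g [f [gp fn ->]]].
have [s sn ->] := IH f an fn; case/primeP: pp => _ /(_ g gp) /pred2P[->|->].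
  by exists s; rewrite ?mul1n // mem_cat sn.
by exists (p :: s); rewrite ?prodl_cons // mem_cat map_f ?orbT.
Qed.

Lemma sublists_sub n s : s \in sublists n -> (size s <= size n)%N /\ {subset s <= n}.
Proof.
elim: n s => [|p n IH] s /=; first by rewrite inE => /eqP ->.
rewrite mem_cat => /orP[/IH[h1 h2]|/mapP[s' /IH[h1 h2] ->]]; split=> //=.
- exact: leqW.
- by move=> x /h2 xn; rewrite inE xn orbT.
- by move=> x; rewrite !inE => /orP[->|/h2 ->] //; rewrite orbT.
Qed.

Lemma ell_grid G s : all (leq 1) s ->
  INR (ell (grid G) s) <= INR G * ln (INR (prodl s)) <= INR (ell (grid G) s) + INR (size s).
Proof.
elim: s => [|p s IH] /=.
  by rewrite /prodl /ell !big_nil /= ln_1; lra.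
move=> /andP[p0 /[dup] hs /IH {}IH]; have := grid_bounds G p0.
have s0 : (0 < prodl s)%N.
  by rewrite /prodl big_seq; apply: prodn_cond_gt0 => x; apply: (allP hs).
rewrite prodl_cons INR_muln ln_mult; try exact: INR_gt0.
by rewrite ell_cons INR_addn -/(size s).+1 -/(INR (size s).+1) S_INR; lra.
Qed.

Lemma sub_in_count (T : eqType) (a b : pred T) (s : seq T) :
  {in s, subpred a b} -> (count a s <= count b s)%N.
Proof.
move=> ab; rewrite (@eq_in_count _ a [pred x | a x && b x]).
  by apply: sub_count => x /andP[].
by move=> x xs /=; case: (boolP (a x)) => // /(ab x xs) ->.
Qed.

(** A list has at most [N] primes, so with mesh [1 / N.+1] the total rounding error in the logarithm
    stays below 1. The values [ell s] therefore lie among the [2 * G] consecutive integers ending at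
    [T], which two adjacent windows cover. *)
Lemma count_inwin N n c u : n \in plists N -> (0 < c)%N ->
  (count (fun s => inwin u (c * prodl s)) (sublists n) <= 2 * cmax (grid N.+1) N.+1 n)%N.
Proof.
move=> nN c0; have C0 := INR_gt0 c0.
pose G := N.+1; pose T := flr (INR G * (u - ln (INR c)) + INR G).
have /andP[_ /allP an] := path_plists nN.
apply: (@leq_trans (cnt (grid G) G n T + cnt (grid G) G n (T + G))); last first.
  by rewrite mul2n -addnn leq_add // cmax_sup.
rewrite /cnt -count_predUI; apply: leq_trans (leq_addr _ _).
apply: sub_in_count => s sn /inwinP [h1 h2] /=.
have [zs ss] := sublists_sub sn.
have as1 : all (leq 1) s by apply/allP => x /ss /an /prime_gt0.
have s0 : (0 < prodl s)%N.
  by rewrite /prodl big_seq; apply: prodn_cond_gt0 => x; apply: (allP as1).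
have S0 := INR_gt0 s0; have [e1 e2] := ell_grid G as1.
have zN : INR (@size nat s) <= INR G - 1.
  have h : INR (@size nat s) <= INR N := INR_leq (leq_trans zs (size_plists nN)).
  by rewrite /G S_INR; lra.
have G1 : 0 < INR G by exact: INR_gt0.
have l1 : u < ln (INR c) + ln (INR (prodl s)).
  rewrite -ln_mult // -INR_muln -[X in X < _]ln_exp; apply: ln_increasing => //; exact: exp_pos.
have l2 : ln (INR c) + ln (INR (prodl s)) <= u + 1.
  rewrite -ln_mult // -INR_muln -[X in _ <= X]ln_exp; apply: ln_le => //.
  by rewrite INR_muln; apply: Rmult_lt_0_compat.
have m1 := Rmult_lt_compat_l _ _ _ G1 l1; have m2 := Rmult_le_compat_l _ _ _ (Rlt_le _ _ G1) l2.
have E0 := pos_INR (ell (grid G) s).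
have [t1 t2] := @flr_bounds (INR G * (u - ln (INR c)) + INR G) ltac:(lra).
rewrite -/T in t1 t2.
have hT : (ell (grid G) s <= T)%N.
  rewrite -ltnS; apply/ltP; apply: INR_lt; rewrite S_INR; lra.
have hT' : (T < ell (grid G) s + 2 * G)%N.
  by apply/ltP; apply: INR_lt; rewrite INR_addn INR_muln (_ : INR 2 = 2) //; lra.
rewrite /win; lia.
Qed.

(** A divisor is [g * e] with [g] dividing [k ^ 2] and [e] the product of a sublist; for fixed [g],
    [e] is confined to one window. *)
Lemma Delta_u_le N k n u : (0 < k)%N -> n \in plists N ->
  (Delta_u (k ^ 2 * prodl n) u <= ndiv k ^ 2 * (2 * cmax (grid N.+1) N.+1 n))%N.
Proof.
move=> k0 nN; have /andP[_ an] := path_plists nN.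
have k20 : (0 < k ^ 2)%N by rewrite expn_gt0 k0.
have m0 : (0 < k ^ 2 * prodl n)%N by rewrite muln_gt0 k20 (plists_gt0 nN).
rewrite Delta_uE //.
pose S g := [seq (g * prodl s)%N | s <- sublists n & inwin u (g * prodl s)].
apply: (@leq_trans (size (flatten [seq S g | g <- divisors (k ^ 2)]))).
  apply: uniq_leq_size; first by rewrite filter_uniq // iota_uniq.
  move=> d; rewrite mem_filter => /andP[/andP[/(divisor_split k20)[g [e [gk en ->]]] hu] _].
  have [s sn eE] := dvd_prodl an en; apply/flatten_mapP; exists g; first by rewrite -dvdn_divisors.
  by apply/mapP; exists s; rewrite ?mem_filter -?eE ?hu.
rewrite size_flatten /shape sumnE !big_map.
apply: (@leq_trans (\sum_(g <- divisors (k ^ 2)) 2 * cmax (grid N.+1) N.+1 n)%N).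
  rewrite !big_seq; apply: leq_sum => g; rewrite -dvdn_divisors // => /(dvdn_gt0 k20) g0.
  by rewrite size_map size_filter; exact: count_inwin.
rewrite big_const_seq count_predT iter_addn_0 mulnC leq_mul2r -mulnn -/(ndiv _) -mulnn.
by rewrite ndivM ?orbT.
Qed.

(** As [real] sends both infinities to 0, they must be excluded: one by the bound [b], the other by
    the value at [u = 0]. *)
Lemma DeltaEH_bounds m b : 0 <= b -> (forall u, INR (Delta_u m u) <= b) -> 0 <= DeltaEH m <= b.
Proof.
move=> b0 H; rewrite /DeltaEH.
set E := fun y => exists u, y = INR (Delta_u m u).
have [hu hl] := Lub_Rbar_correct E.
have h1 : Rbar_le (Lub_Rbar E) b by apply: hl => y [u ->]; exact: H.
have h2 := hu (INR (Delta_u m 0)) (ex_intro _ 0 erefl).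
case: (Lub_Rbar E) h1 h2 => //= r h1 h2.
by have := pos_INR (Delta_u m 0); lra.
Qed.

Lemma sum_leE x f : sum_le x f = \sum_(1 <= m < (flr x).+1) f m.
Proof.
rewrite /sum_le -/(flr x) seq_iota unlock /index_iota subSS subn0.
by elim: (iota _ _) => //= m s ->.
Qed.

Lemma sum_Delta_le N : \sum_(1 <= m < N.+1) DeltaEH m <=
  \sum_(1 <= k < N.+1) \sum_(n <- plists N | (k ^ 2 * prodl n <= N)%N)
     (INR (ndiv k) ^ 2 * (2 * INR (cmax (grid N.+1) N.+1 n))).
Proof.
pose b k n := INR (ndiv k) ^ 2 * (2 * INR (cmax (grid N.+1) N.+1 n)).
have b0 k n : 0 <= b k n.
  by apply: Rmult_le_pos; [apply: pow_le; exact: pos_INR|have := pos_INR (cmax (grid N.+1) N.+1 n); lra].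
have key m : m \in index_iota 1 N.+1 -> DeltaEH m <= 
    \sum_(1 <= k < N.+1) \sum_(n <- plists N) (if m == (k ^ 2 * prodl n)%N then b k n else 0).
  rewrite mem_index_iota ltnS => hm; have [k [n [hk nN mE]]] := square_primes_decomp hm.
  apply: (@Rle_trans _ (b k n)).
    have [] // := @DeltaEH_bounds m (b k n) (b0 k n).
    move=> u; have := INR_leq (@Delta_u_le N k n u ltac:(lia) nN).
    by rewrite -mE INR_muln INR_expn INR_muln (_ : INR 2 = 2).
  have t0 k' n' : 0 <= (if m == (k' ^ 2 * prodl n')%N then b k' n' else 0).
    by case: ifP => _; [exact: b0|lra].
  have h1 := @leR_sum_term _ _ (fun n => if m == (k ^ 2 * prodl n)%N then b k n else 0) _ nN.
  rewrite -mE eqxx in h1; apply: Rle_trans (h1 (fun n' _ => t0 k n')) _.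
  apply: (@leR_sum_term _ _ (fun k => \sum_(n <- plists N) (if m == (k ^ 2 * prodl n)%N then b k n else 0))).
    by rewrite mem_index_iota ltnS.
  by move=> k' _; apply: sumR_ge0.
apply: (@Rle_trans _ (\sum_(1 <= m < N.+1) \sum_(1 <= k < N.+1) \sum_(n <- plists N)
   (if m == (k ^ 2 * prodl n)%N then b k n else 0))).
  by apply: leR_sum => m mI _; exact: key.
rewrite exchange_big; apply: leR_sum => k _ _; rewrite exchange_big [X in _ <= X]big_mkcond.
apply: leR_sum => n _ _; case: ifP => h; first by apply: sum_eq_le1 => //; exact: iota_uniq.
rewrite big1_seq => [|m /=]; first lra.
by rewrite mem_index_iota ltnS; case: eqP => // ->; rewrite h andbF.
Qed.

Lemma ln_le_two_sqrt k : (0 < k)%N -> 5 + 2 * ln (INR k) <= 9 * sqrt (INR k).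
Proof.
move=> k0; have K1 := INR_ge1 k0.
have s1 : 1 <= sqrt (INR k) by rewrite -{1}sqrt_1; apply: sqrt_le_1_alt.
rewrite -{1}(sqrt_sqrt (INR k)); last lra.
rewrite ln_mult; try lra.
have := exp_ineq1_le (ln (sqrt (INR k))); rewrite exp_ln; lra.
Qed.

(* Multiplying by [1 + ln N] and splitting
   [ln N = ln (N / (k ^ 2 * prodl n)) + 2 * ln k + ln (prodl n)]. *)
Lemma sum_pairs_le N (h : seq nat -> R) : (0 < N)%N -> (forall n, 0 <= h n) ->
  (forall n p, p \in n -> h n <= 2 * h (rem p n)) ->
  (1 + ln (INR N)) *
    \sum_(1 <= k < N.+1) \sum_(n <- plists N | (k ^ 2 * prodl n <= N)%N) (INR (ndiv k) ^ 2 * h n) <=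
  729 * INR N * \sum_(n <- plists N) (h n / INR (prodl n)).
Proof.
move=> N0 h0 hrem; have NR := INR_gt0 N0.
set H := \sum_(n <- plists N) _.
have H0 : 0 <= H.
  apply: sumR_ge0 => n /plists_gt0/INR_gt0 n0 _.
  by apply: Rcomplements.Rdiv_le_0_compat.
apply: (@Rle_trans _ (\sum_(1 <= k < N.+1) (9 * INR N * H * (w32 k * INR (ndiv k) ^ 2)))).
  rewrite -sumR_mulr; apply: leR_sum => k; rewrite mem_index_iota => /andP[k0 _] _.
  have K0 := INR_gt0 k0; have t0 : 0 <= INR (ndiv k) ^ 2 by apply: pow_le; exact: pos_INR.
  rewrite sumR_mulr.
  suff : (1 + ln (INR N)) * \sum_(n <- plists N | (k ^ 2 * prodl n <= N)%N) h n <= 9 * INR N * H * w32 k.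
    move=> /(Rmult_le_compat_l _ _ _ t0) hs; rewrite (_ : forall a b c, a * (b * c) = b * (a * c)); last by move=> *; lra.
    by apply: Rle_trans hs _; apply: Req_le; lra.
  have a0 : (0 < k ^ 2)%N by rewrite expn_gt0 k0.
  have A0 := INR_gt0 a0; have aE : INR (k ^ 2) = INR k * INR k by rewrite INR_expn /=; lra.
  have l0 : 0 <= ln (INR k) by apply: ln_ge0; exact: INR_ge1.
  have := sum_plists_ln N a0 h0 hrem; rewrite -/H => h3.
  have h1 : \sum_(n <- plists N | (k ^ 2 * prodl n <= N)%N)
       (h n * ((1 + 2 * ln (INR k)) * (INR N / INR (k ^ 2)) / INR (prodl n))) <=
     (1 + 2 * ln (INR k)) * (INR N / INR (k ^ 2)) * H.
    rewrite /H -sumR_mulr [X in X <= _]big_mkcond; apply: leR_sum => n /plists_gt0/INR_gt0 n0 _.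
    have : 0 <= (1 + 2 * ln (INR k)) * (INR N / INR (k ^ 2)) * (h n / INR (prodl n)).
      apply: Rmult_le_pos; last exact: Rcomplements.Rdiv_le_0_compat.
      by apply: Rmult_le_pos; [lra|apply: Rcomplements.Rdiv_le_0_compat; lra].
    by case: ifP => _ //; rewrite /Rdiv; lra.
  have h2 : (1 + ln (INR N)) * \sum_(n <- plists N | (k ^ 2 * prodl n <= N)%N) h n <=
    \sum_(n <- plists N | (k ^ 2 * prodl n <= N)%N)
       (h n * ((1 + 2 * ln (INR k)) * (INR N / INR (k ^ 2)) / INR (prodl n)))
    + \sum_(n <- plists N | (k ^ 2 * prodl n <= N)%N) (h n * ln (INR (prodl n))).
    rewrite -sumR_mulr -big_split /=; apply: leR_sum => n /plists_gt0 n0 hn.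
    have N1 := INR_gt0 n0.
    have r1 : 1 <= INR N / INR (k ^ 2) / INR (prodl n).
      have d0 : 0 < INR (k ^ 2) * INR (prodl n) by apply: Rmult_lt_0_compat.
      apply: (Rmult_le_reg_r (INR (k ^ 2) * INR (prodl n))) => //.
      have -> : INR N / INR (k ^ 2) / INR (prodl n) * (INR (k ^ 2) * INR (prodl n)) = INR N by field; lra.
      by rewrite Rmult_1_l -INR_muln; exact: INR_leq.
    have lE : ln (INR N) = ln (INR N / INR (k ^ 2) / INR (prodl n)) + 2 * ln (INR k) + ln (INR (prodl n)).
      rewrite /Rdiv !ln_mult ?ln_Rinv ?aE ?ln_mult //; try lra; try exact: Rmult_lt_0_compat.
      - by apply: Rinv_0_lt_compat; rewrite -aE.
      - by apply: Rmult_lt_0_compat => //; apply: Rinv_0_lt_compat; rewrite -aE.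
      - exact: Rinv_0_lt_compat.
    have := exp_ineq1_le (ln (INR N / INR (k ^ 2) / INR (prodl n))); rewrite exp_ln; last lra.
    move: lE r1; rewrite [(1 + 2 * _) * _ / _](_ : _ =
       (1 + 2 * ln (INR k)) * (INR N / INR (k ^ 2) / INR (prodl n))); last by rewrite /Rdiv; lra.
    move: (INR N / INR (k ^ 2) / INR (prodl n)) => r lE r1 hr.
    rewrite lE -Rmult_plus_distr_l [_ * h n]Rmult_comm; apply: Rmult_le_compat_l => //.
    have : 0 <= ln (INR k) * (r - 1) by apply: Rmult_le_pos; lra.
    lra.
  (* Here [5 = 1 + 4], the 4 coming from [sum_plists_ln]. The factor is absorbed by [9 * sqrt k],
     which turns [k ^ (- 2)] into [w32 k]. *)
  apply: (@Rle_trans _ ((5 + 2 * ln (INR k)) * (INR N / INR (k ^ 2) * H))); first lra.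
  have s0 : 0 < sqrt (INR k) by apply: sqrt_lt_R0.
  have -> : 9 * INR N * H * w32 k = 9 * sqrt (INR k) * (INR N / INR (k ^ 2) * H).
    have ss := sqrt_sqrt (INR k) (Rlt_le _ _ K0).
    rewrite /w32 aE; have -> : INR N / (INR k * INR k) = INR N / (INR k * (sqrt (INR k) * sqrt (INR k))) by rewrite ss.
    by field; lra.
  apply: Rmult_le_compat_r; last exact: ln_le_two_sqrt.
  by apply: Rmult_le_pos => //; apply: Rcomplements.Rdiv_le_0_compat; lra.
rewrite sumR_mulr (_ : 729 * INR N * H = 9 * INR N * H * 81); last lra.
apply: Rmult_le_compat_l; last exact: sum_ndiv2_w32.
by apply: Rmult_le_pos => //; lra.
Qed.

(** The factor [1 + ln N] of [sum_pairs_le] cancels against [exp (isum N) <= 729 * (1 + ln N)]. The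
    constant uses [2 * 729 ^ 2 <= 10 ^ 7] and the [10 ^ 9] of [mean_cmax]. *)
Lemma sum_Delta_model N Q : (0 < N)%N -> (0 < Q)%N -> lam qpr N <= 3 ^ Q ->
  \sum_(1 <= m < N.+1) DeltaEH m <= 10 ^ 16 * 39366 * INR N * (INR Q * root4 (INR Q) ^ 7).
Proof.
move=> N0 Q0 hQ; have N1 := INR_ge1 N0; have L0 : 0 <= ln (INR N) by apply: ln_ge0.
pose h n := 2 * INR (cmax (grid N.+1) N.+1 n).
have h0 n : 0 <= h n by have := pos_INR (cmax (grid N.+1) N.+1 n); rewrite /h; lra.
have hrem n p : p \in n -> h n <= 2 * h (rem p n).
  move=> /(cmax_rem (grid N.+1) (ltn0Sn N))/INR_leq; rewrite INR_muln (_ : INR 2 = 2) // /h; lra.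
have := @sum_pairs_le N h N0 h0 hrem; rewrite /h.
have := sum_Delta_le N; set S := \sum_(1 <= m < _) DeltaEH m => hS hp.
have := sum_plists_le N h0; rewrite /h => hE.
have := mean_cmax qpr_ge0 qpr_le (ltn0Sn N) (ltac:(lra) : 1 <= 39366) (fun m M v w => @grid_window N.+1 m M v w (ltn0Sn N)) Q0 hQ.
rewrite ExZ in hE; set E := Ex _ _ _ in hE *; set W := INR Q * _ => hm.
have hI : exp (isum N) <= 729 * (1 + ln (INR N)).
  have := @exp_isum N (Rmax 2 (INR N)) (Rmax_r _ _) (Rmax_l _ _).
  have := ln2_bounds; rewrite /Rmax; case: Rle_dec; lra.
have E0 : 0 <= E by apply: (Ex_ge0 qpr_ge0 qpr_le) => n _; exact: pos_INR.
have l1 : 0 < 1 + ln (INR N) by lra.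
apply: (Rmult_le_reg_l (1 + ln (INR N))) => //.
apply: Rle_trans (Rmult_le_compat_l _ _ _ (Rlt_le _ _ l1) hS) _.
apply: Rle_trans hp _.
have n0 : 0 <= 729 * INR N by lra.
apply: Rle_trans (Rmult_le_compat_l _ _ _ n0 hE) _.
apply: (@Rle_trans _ (729 * INR N * (729 * (1 + ln (INR N)) * (2 * (1000000000 * 39366 * W))))).
  apply: Rmult_le_compat_l => //; apply: Rmult_le_compat; try lra.
  exact/Rlt_le/exp_pos.
have W0 : 0 <= W.
  by apply: Rmult_le_pos; [exact: pos_INR|apply: pow_le; exact: root4_ge0].
have : 0 <= (1 + ln (INR N)) * INR N * W by apply: Rmult_le_pos => //; apply: Rmult_le_pos; lra.
by rewrite (_ : 10 ^ 16 = 10000000000000000); [lra|rewrite /=; lra].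
Qed.

(** * The final estimate *)

Lemma root4_Rpower y : 0 < y -> y * root4 y ^ 7 = Rpower y (11 / 4).
Proof.
move=> y0; have r0 : root4 y = Rpower y (/ 4).
  rewrite /root4 -!Rpower_sqrt //; last exact: exp_pos.
  by rewrite Rpower_mult; congr (Rpower _ _); lra.
rewrite r0 -Rpower_pow; last exact: exp_pos.
rewrite Rpower_mult -{1}(Rpower_1 _ y0) -Rpower_plus; congr (Rpower _ _); rewrite /=; lra.
Qed.

Lemma Log_ge1 x : 1 <= Log x. Proof. exact: Rmax_l. Qed.

Lemma exp_INR_le n : exp (INR n) <= 3 ^ n.
Proof.
elim: n => [|n IH]; first by rewrite exp_0 /=; lra.
rewrite S_INR exp_plus Rmult_comm -tech_pow_Rmult.
by apply: Rmult_le_compat => //; [exact/Rlt_le/exp_pos|exact/Rlt_le/exp_pos|exact: exp_le_3].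
Qed.

Lemma DeltaEH_ge0 m : 0 <= DeltaEH m.
Proof.
have [] // := @DeltaEH_bounds m (INR m) (pos_INR m) => u.
apply: INR_leq; rewrite /Delta_u seq_iota (@length_filter _ _ _ _ (frefl _)).
by rewrite size_filter; apply: leq_trans (count_size _ _) _; rewrite size_iota.
Qed.

Theorem theorem1p1 :
  exists C : R, 0 < C /\
    forall x : R, 1 <= x ->
      Rabs (sum_le x DeltaEH) <= C * (x * Rpower (Log2 x) (11/4)).
Proof.
exists (10 ^ 16 * 39366 * 512); split.
  by apply: Rmult_lt_0_compat; [apply: Rmult_lt_0_compat; [apply: pow_lt|]|]; lra.
move=> x x1; rewrite sum_leE; set N := flr x.
have [n1 n2] := @flr_bounds x ltac:(lra); rewrite -/N in n1 n2.
have N0 : (0 < N)%N.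
  by rewrite lt0n; apply/eqP => e; rewrite e /= in n2; lra.
have N1 := INR_ge1 N0.
rewrite Rabs_pos_eq; last by apply: sumR_ge0 => m _ _; exact: DeltaEH_ge0.
set L := Log2 x; have L1 : 1 <= L by exact: Log_ge1.
have [f1 f2] := @flr_bounds L ltac:(lra).
(* The 6 pays for [729 = 3 ^ 6] in Mertens' bound, the rest for
   [Log x <= exp L <= 3 ^ (flr L).+1]. *)
pose Q := (6 + (flr L).+1)%N.
have lx1 := Log_ge1 x; have lx : ln x <= Log x by exact: Rmax_r.
have hlog : Log x <= exp L.
  rewrite -[X in X <= _]exp_ln; last lra.
  have : ln (Log x) <= L by exact: Rmax_r.
  by case=> [/exp_increasing|->]; lra.
have hQ : lam qpr N <= 3 ^ Q.
  apply: Rle_trans (lam_qpr_le N) _.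
  apply: Rle_trans (exp_isum (Rmax_r 2 (INR N)) (Rmax_l 2 (INR N))) _.
  have hz : ln (Rmax 2 (INR N)) <= Log x.
    rewrite /Rmax; case: Rle_dec => _; last by have := ln2_bounds; lra.
    by apply: Rle_trans lx; apply: ln_le; lra.
  have h3 : exp L <= 3 ^ (flr L).+1.
    apply: Rle_trans (exp_INR_le _); apply: Rlt_le; apply: exp_increasing.
    by rewrite S_INR.
  rewrite /Q pow_add (_ : 3 ^ 6 = 729); last by rewrite /=; lra.
  by apply: Rmult_le_compat_l; lra.
apply: Rle_trans (sum_Delta_model N0 (isT : (0 < Q)%N) hQ) _.
have Q0 : 0 < INR Q by exact: INR_gt0.
have Q8 : INR Q <= 8 * L.
  by rewrite /Q INR_addn (S_INR (flr L)) (_ : INR 6 = 6) /=; lra.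
rewrite root4_Rpower //.
have hR : Rpower (INR Q) (11 / 4) <= 512 * Rpower L (11 / 4).
  apply: (@Rle_trans _ (Rpower (8 * L) (11 / 4))); first by apply: Rle_Rpower_l; lra.
  rewrite -Rpower_mult_distr; try lra.
  apply: Rmult_le_compat_r; first exact/Rlt_le/exp_pos.
  (* The 512 of the final constant is [8 ^ 3 >= 8 ^ (11 / 4)], with 8 from [Q <= 8 * L]. *)
  apply: (@Rle_trans _ (Rpower 8 (INR 3))); first by apply: Rle_Rpower; rewrite /=; lra.
  by rewrite Rpower_pow /=; lra.
have R0 : 0 < Rpower L (11 / 4) by exact: exp_pos.
have c0 : 0 <= 10 ^ 16 * 39366 by apply: Rmult_le_pos; [apply: pow_le|]; lra.
have h : INR N * Rpower (INR Q) (11 / 4) <= x * (512 * Rpower L (11 / 4)).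
  by apply: Rmult_le_compat => //; [exact: pos_INR|exact/Rlt_le/exp_pos].
by have := Rmult_le_compat_l _ _ _ c0 h; lra.
Qed.
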